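(* Let $M$ be a surface of revolution endowed with its strongly convex slope metric $F=\frac{\alpha^2}{\alpha-\beta}$. Then $F$ is not projectively equivalent to the Riemannian metric $\alpha$ of $M$, and $F$ is not projectively flat.
   Context: Let $I\subset\mathbb{R}$ be an open interval and $m:I\to(0,\infty)$ smooth. The surface of revolution $M\to\mathbb{R}^3$ is $(u,v)\mapsto(m(u)\cos v,\,m(u)\sin v,\,u)$, $u\in I$, $v\in\mathbb{S}^1$. Its slope metric is $F=\frac{\alpha^2}{\alpha-\beta}$ with $\alpha=\sqrt{[1+(m')^2]\dot u^2+m^2\dot v^2}$ (the norm of the Riemannian metric induced from $\mathbb{R}^3$) and $\beta=\dot u$, in the canonical coordinates $(u,v,\dot u,\dot v)$ of $TM$; it is strongly convex when $\alpha>\beta$ and $\frac12\frac{\partial^2F^2}{\partial y^i\partial y^j}$ (with $(y^1,y^2)=(\dot u,\dot v)$) is positive definite on all nonzero tangent vectors. Two (Finsler or Riemannian) metrics on $M$ are projectively equivalent if they have the same geodesics as oriented point sets (up to reparametrization). A Finsler metric is projectively flat if around every point there are local coordinates in which all its geodesics are straight line segments. *)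

(* Defs.v *)
From Stdlib Require Export Reals.
From Coquelicot Require Export Coquelicot.
Open Scope R_scope.

(* An open interval of R, bounded or not; it is nonempty iff Rbar_lt a b. *)
Definition open_itv (a b : Rbar) (x : R) : Prop := Rbar_lt a x /\ Rbar_lt x b.

(* C^oo on an open subset of R, resp. of R^2. *)
Definition smooth (D : R -> Prop) (f : R -> R) : Prop :=
  forall x, D x -> forall n, ex_derive_n f n x.

Definition smooth2 (D : R * R -> Prop) (f : R * R -> R) : Prop :=
  forall x y, D (x, y) -> forall n, ex_diff_n (fun a b => f (a, b)) n x y.

(* The surface of revolution M, as a subset of R^3 parametrized by the canonical
   coordinates (u, v); the coordinate v is an angle, defined modulo 2 * PI. *)
Definition rev_param (m : R -> R) (x : R * R) : R * R * R :=
  (m (fst x) * cos (snd x), m (fst x) * sin (snd x), fst x).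

Definition rev_surface (lo hi : Rbar) (m : R -> R) (p : R * R * R) : Prop :=
  exists u v, open_itv lo hi u /\ p = rev_param m (u, v).

(* Metrics on M are written in the canonical coordinates of TM:
   L u v du dv is the norm of the tangent vector (du, dv) at (u, v). *)
Definition metric := R -> R -> R -> R -> R.

Definition alpha (m : R -> R) : metric := fun u v du dv =>
  sqrt ((1 + (Derive m u) ^ 2) * du ^ 2 + (m u) ^ 2 * dv ^ 2).

Definition beta : metric := fun u v du dv => du.

Definition slope (m : R -> R) : metric := fun u v du dv =>
  (alpha m u v du dv) ^ 2 / (alpha m u v du dv - beta u v du dv).

(* The Hessian g_ij = 1/2 d^2(L^2)/dy^i dy^j, with (y^1, y^2) = (du, dv). *)
Definition g11 (L : metric) : metric := fun u v du dv =>
  / 2 * Derive (fun a => Derive (fun b => (L u v b dv) ^ 2) a) du.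
Definition g12 (L : metric) : metric := fun u v du dv =>
  / 2 * Derive (fun a => Derive (fun b => (L u v a b) ^ 2) dv) du.
Definition g22 (L : metric) : metric := fun u v du dv =>
  / 2 * Derive (fun a => Derive (fun b => (L u v du b) ^ 2) a) dv.

Definition hessian_posdef (lo hi : Rbar) (L : metric) : Prop :=
  forall u v du dv, open_itv lo hi u -> (du, dv) <> (0, 0) ->
  forall w1 w2, (w1, w2) <> (0, 0) ->
    0 < g11 L u v du dv * w1 ^ 2 + 2 * g12 L u v du dv * (w1 * w2)
        + g22 L u v du dv * w2 ^ 2.

Definition slope_strongly_convex (lo hi : Rbar) (m : R -> R) : Prop :=
  (forall u v du dv, open_itv lo hi u -> (du, dv) <> (0, 0) ->
     beta u v du dv < alpha m u v du dv) /\
  hessian_posdef lo hi (slope m).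

(* Constant-speed geodesics of L on the parameter interval (a, b): regular
   solutions of the Euler-Lagrange equations of the energy L^2/2,
     d/dt (dE/dy^i) = dE/dx^i   along (u, v, u', v').
   Every curve in M lifts to a curve t |-> (u t, v t) in the universal cover of
   M, unique up to a translation of v by a multiple of 2 * PI. *)
Definition energy (L : metric) : metric := fun u v du dv => (L u v du dv) ^ 2 / 2.

Definition E_u (L : metric) : metric := fun u v du dv =>
  Derive (fun x => energy L x v du dv) u.
Definition E_v (L : metric) : metric := fun u v du dv =>
  Derive (fun x => energy L u x du dv) v.
Definition E_du (L : metric) : metric := fun u v du dv =>
  Derive (fun y => energy L u v y dv) du.
Definition E_dv (L : metric) : metric := fun u v du dv =>
  Derive (fun y => energy L u v du y) dv.

Definition geodesic (lo hi : Rbar) (m : R -> R) (L : metric)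
    (a b : Rbar) (c : R -> R * R * R) : Prop :=
  Rbar_lt a b /\
  exists u v : R -> R, forall t, open_itv a b t ->
    open_itv lo hi (u t) /\
    c t = rev_param m (u t, v t) /\
    ex_derive u t /\ ex_derive v t /\
    ex_derive (Derive u) t /\ ex_derive (Derive v) t /\
    (Derive u t, Derive v t) <> (0, 0) /\
    is_derive (fun s => E_du L (u s) (v s) (Derive u s) (Derive v s)) t
              (E_u L (u t) (v t) (Derive u t) (Derive v t)) /\
    is_derive (fun s => E_dv L (u s) (v s) (Derive u s) (Derive v s)) t
              (E_v L (u t) (v t) (Derive u t) (Derive v t)).

(* c on (a, b) and c' on (a', b') agree up to an orientation-preserving
   diffeomorphism h of (a, b) onto (a', b'). *)
Definition same_oriented_curve (a b : Rbar) (c : R -> R * R * R)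
    (a' b' : Rbar) (c' : R -> R * R * R) : Prop :=
  exists h : R -> R,
    smooth (open_itv a b) h /\
    (forall t, open_itv a b t ->
       0 < Derive h t /\ open_itv a' b' (h t) /\ c t = c' (h t)) /\
    (forall s, open_itv a' b' s -> exists t, open_itv a b t /\ h t = s).

Definition proj_equivalent (lo hi : Rbar) (m : R -> R) (L1 L2 : metric) : Prop :=
  (forall a b c, geodesic lo hi m L1 a b c ->
     exists a' b' c', geodesic lo hi m L2 a' b' c' /\
                      same_oriented_curve a b c a' b' c') /\
  (forall a b c, geodesic lo hi m L2 a b c ->
     exists a' b' c', geodesic lo hi m L1 a' b' c' /\
                      same_oriented_curve a b c a' b' c').

(* Local coordinates of M: phi is a diffeomorphism, with inverse chi, of the
   open subset U of M (the trace on M of an open subset of R^3) onto the open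
   subset V of R^2.  Smoothness of phi is tested through rev_param, a local
   diffeomorphism onto M; chi is smooth into M iff it is smooth into R^3,
   because M is embedded. *)
Definition local_coordinates (lo hi : Rbar) (m : R -> R)
    (U : R * R * R -> Prop) (V : R * R -> Prop)
    (phi : R * R * R -> R * R) (chi : R * R -> R * R * R) : Prop :=
  let D := fun x : R * R => open_itv lo hi (fst x) /\ U (rev_param m x) in
  open U /\ open V /\
  (forall p, rev_surface lo hi m p -> U p -> V (phi p) /\ chi (phi p) = p) /\
  (forall x, V x ->
     rev_surface lo hi m (chi x) /\ U (chi x) /\ phi (chi x) = x) /\
  smooth2 D (fun x => fst (phi (rev_param m x))) /\
  smooth2 D (fun x => snd (phi (rev_param m x))) /\
  smooth2 V (fun x => fst (fst (chi x))) /\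
  smooth2 V (fun x => snd (fst (chi x))) /\
  smooth2 V (fun x => snd (chi x)).

(* Geodesics being parametrized by open intervals, their segments are open;
   they may be unbounded if the coordinate domain is. *)
Definition straight_segment (S : R * R -> Prop) : Prop :=
  exists (q d : R * R) (a b : Rbar),
    d <> (0, 0) /\ Rbar_lt a b /\
    forall x, S x <-> exists s, open_itv a b s /\
                        x = (fst q + s * fst d, snd q + s * snd d).

Definition proj_flat (lo hi : Rbar) (m : R -> R) (L : metric) : Prop :=
  forall p, rev_surface lo hi m p ->
  exists U V phi chi,
    local_coordinates lo hi m U V phi chi /\ U p /\
    forall a b c, geodesic lo hi m L a b c ->
      (forall t, open_itv a b t -> U (c t)) ->
      straight_segment (fun x => exists t, open_itv a b t /\ x = phi (c t)).

(* Main.v *)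
Require Import Defs.
From Stdlib Require Import Reals Lra ClassicalEpsilon.
From Coquelicot Require Import Coquelicot.
Open Scope R_scope.

(** A geodesic that crosses the parallels can be written as a graph v = V(u), run
    through in the direction e = 1 of increasing u or e = -1 of decreasing u.
    Put w = V', p = m', A = sqrt (1 + p^2 + m^2 w^2) and

      X = 2 p w + m w',     Y = p m'' + m p w^2 + m^2 w w',
      Z = p m'' - m p w^2 = p (m'' - m w^2).

    The angle v is cyclic, so its momentum is constant along a geodesic
    (Clairaut's relation); differentiating this along the graph gives

      for F:      A (A - e) (A - 2 e) X + m w (3 e - A) Y = 0,
      for alpha:  (1 + p^2) X = m w Z,

    and each equation determines w' at a point from the direction w there.  The
    quantity Z is, up to a nonzero factor, the Hessian of the function u on M
    evaluated on the direction; it is what a change of direction e and the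
    passage from F to alpha make visible: if the curve with e = 1 has the same
    w' as the curve with e = -1, or as the alpha-geodesic, then Z = 0
    ([opposite_graph_equations_incompatible], [graph_equations_incompatible]).

    The condition beta < alpha on meridians forces p <> 0, so Z <> 0 at any
    point as soon as w is large.  Projective equivalence with alpha would give
    the F-geodesic and the alpha-geodesic through that point the same w'.
    Projective flatness would give the same w' to the F-geodesics with e = 1
    and e = -1: both are straight in the flat coordinates and have the same
    tangent line, and a straight line has no orientation
    ([straight_curve_second_order]).  Both are impossible.

    What takes work is that these F-geodesics exist.  As the metric does not
    depend on v, they come from quadratures: the implicit function theorem
    solves Clairaut's relation for w as a function of u
    ([clairaut_level_curve]), and then the unit speed condition is an autonomous
    equation for u ([autonomous_ode]); [slope_geodesic_of_graph] checks the
    Euler-Lagrange equations. *)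

(** * Implicit functions and autonomous equations on the line *)

Lemma Rabs_lt_intro (a b e : R) : b - e < a < b + e -> Rabs (a - b) < e.
Proof. intros H; apply Rabs_def1; lra. Qed.

Lemma Rabs_lt_elim (a b e : R) : Rabs (a - b) < e -> b - e < a < b + e.
Proof. intros H; apply Rabs_def2 in H; lra. Qed.

Lemma locally_comp (f : R -> R) (x : R) (P : R -> Prop) :
  continuous f x -> locally (f x) P -> locally x (fun z => P (f z)).
Proof. intros Hf HP. exact (Hf P HP). Qed.

Lemma locally_near (x0 r x : R) :
  Rabs (x - x0) < r -> locally x (fun z => Rabs (z - x0) < r).
Proof.
  intros Hx. apply (locally_comp (fun z => Rabs (z - x0)) x (fun z => z < r)).
  - apply (continuous_comp (fun z => z - x0) Rabs).
    + apply (continuous_minus (U:=R_UniformSpace) (V:=R_NormedModule));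
        [apply continuous_id|apply continuous_const].
    + apply continuous_Rabs.
  - now apply open_lt.
Qed.

Lemma differentiable_of_partials (G Gx Gy : R -> R -> R) (x y : R) :
  locally_2d (fun a b => is_derive (fun z => G z b) a (Gx a b)) x y ->
  is_derive (fun z => G x z) y (Gy x y) ->
  continuity_2d_pt Gx x y ->
  differentiable_pt_lim G x y (Gx x y) (Gy x y).
Proof.
  intros Hx Hy Hc.
  apply filterdiff_differentiable_pt_lim.
  apply (is_derive_filterdiff G x y Gx (Gy x y)).
  - now apply locally_2d_locally in Hx.
  - exact Hy.
  - now apply continuity_2d_pt_filterlim in Hc.
Qed.

(** The first-order expansion of [G] along the level curve first shows that [f]
    is Lipschitz at [x], which then turns the error term, small with respect to
    the larger of the two increments, into one small with respect to that of x. *)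
Lemma is_derive_level_curve (G : R -> R -> R) (f : R -> R) (x gx gy : R) :
  differentiable_pt_lim G x (f x) gx gy -> 0 < gy ->
  continuous f x -> locally x (fun z => G z (f z) = G x (f x)) ->
  is_derive f x (- gx / gy).
Proof.
  intros HG Hgy Hf Hlev.
  pose (K := 2 * Rabs gx / gy + 1).
  assert (HK : 1 <= K).
  { unfold K, Rdiv. pose proof (Rabs_pos gx).
    assert (0 < / gy) by now apply Rinv_0_lt_compat. nra. }
  assert (Hfc : forall e : posreal, locally x (fun z => Rabs (f z - f x) < e)).
  { intros e. apply (proj1 (filterlim_locally _ _) Hf e). }
  assert (Hnear : forall e : posreal, locally x (fun z =>
     Rabs (gx * (z - x) + gy * (f z - f x))
       <= e * Rmax (Rabs (z - x)) (Rabs (f z - f x)))).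
  { intros e. destruct (HG e) as [d Hd].
    generalize (filter_and _ _ Hlev
      (filter_and _ _ (Hfc d) (locally_ball x d))).
    apply filter_imp. intros z [E [Hz1 Hz2]].
    specialize (Hd z (f z) Hz2 Hz1). rewrite E in Hd.
    rewrite <- Rabs_Ropp. eapply Rle_trans; [|exact Hd].
    apply Req_le. f_equal. ring. }
  assert (He : 0 < gy / 2) by lra.
  (* An error of half of gy can be absorbed in the left-hand side. *)
  assert (Hlip : locally x (fun z => Rabs (f z - f x) <= K * Rabs (z - x))).
  { generalize (Hnear (mkposreal _ He)). apply filter_imp. simpl. intros z Hz.
    assert (Hm : Rmax (Rabs (z - x)) (Rabs (f z - f x))
                 <= Rabs (z - x) + Rabs (f z - f x)).
    { pose proof (Rabs_pos (z - x)). pose proof (Rabs_pos (f z - f x)).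
      apply Rmax_lub; lra. }
    assert (Ht : gy * Rabs (f z - f x) <=
       Rabs (gx * (z - x) + gy * (f z - f x)) + Rabs gx * Rabs (z - x)).
    { rewrite <- (Rabs_pos_eq gy) at 1 by lra. rewrite <- !Rabs_mult.
      replace (gy * (f z - f x))
        with ((gx * (z - x) + gy * (f z - f x)) + - (gx * (z - x))) at 1 by ring.
      eapply Rle_trans; [apply Rabs_triang|]. rewrite Rabs_Ropp. lra. }
    apply (Rmult_le_reg_l (gy / 2)); [lra|].
    unfold K. replace (gy / 2 * ((2 * Rabs gx / gy + 1) * Rabs (z - x)))
      with (Rabs gx * Rabs (z - x) + gy / 2 * Rabs (z - x)) by (field; lra).
    nra. }
  apply is_derive_Reals. intros eps Heps.
  assert (He' : 0 < eps / 2 * gy / K).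
  { apply Rdiv_lt_0_compat; [apply Rmult_lt_0_compat|]; lra. }
  destruct (filter_and _ _ Hlip (Hnear (mkposreal _ He'))) as [d Hd].
  exists d. intros h Hh Hhd.
  assert (Hb : ball x d (x + h)).
  { change (Rabs (x + h - x) < d). now replace (x + h - x) with h by ring. }
  destruct (Hd _ Hb) as [H1 H2]. simpl in H2.
  replace (x + h - x) with h in H1, H2 by ring.
  assert (Hh0 : 0 < Rabs h) by now apply Rabs_pos_lt.
  assert (Hm : Rmax (Rabs h) (Rabs (f (x + h) - f x)) <= K * Rabs h).
  { apply Rmax_lub; [nra|exact H1]. }
  replace ((f (x + h) - f x) / h - - gx / gy)
    with ((gx * h + gy * (f (x + h) - f x)) / (gy * h)) by (field; lra).
  unfold Rdiv. rewrite Rabs_mult, Rabs_inv, Rabs_mult, (Rabs_pos_eq gy) by lra.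
  apply (Rmult_lt_reg_r (gy * Rabs h)); [nra|].
  rewrite Rmult_assoc, Rinv_l, Rmult_1_r by nra.
  eapply Rle_lt_trans; [exact H2|].
  apply Rle_lt_trans with (eps / 2 * gy / K * (K * Rabs h)).
  - apply Rmult_le_compat_l; [lra|exact Hm].
  - replace (eps / 2 * gy / K * (K * Rabs h)) with (eps / 2 * (gy * Rabs h))
      by (field; lra).
    apply Rmult_lt_compat_r; nra.
Qed.

(** Monotonicity in the second variable does everything: the solution is
    bracketed between y0 - r/2 and y0 + r/2 and unique there, and bracketing it
    more tightly gives continuity. *)
Lemma implicit_function_pos (G Gx Gy : R -> R -> R) (x0 y0 : R) :
  locally_2d (fun x y =>
    is_derive (fun z => G z y) x (Gx x y) /\
    is_derive (fun z => G x z) y (Gy x y) /\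
    continuity_2d_pt Gx x y /\ continuity_2d_pt Gy x y) x0 y0 ->
  0 < Gy x0 y0 ->
  exists f : R -> R, f x0 = y0 /\
    locally x0 (fun x => G x (f x) = G x0 y0 /\
                         is_derive f x (- Gx x (f x) / Gy x (f x))).
Proof.
  intros Hreg Hpos.
  assert (Hgy : locally_2d (fun x y => 0 < Gy x y) x0 y0).
  { destruct (locally_2d_singleton _ _ _ Hreg) as (_ & _ & _ & Hc).
    destruct (Hc (mkposreal _ Hpos)) as [d Hd]. exists d. intros x y Hx Hy.
    specialize (Hd x y Hx Hy). apply Rabs_lt_elim in Hd. simpl in Hd. lra. }
  destruct (locally_2d_and _ _ _ _ Hreg Hgy) as [r Hr].
  clear Hreg Hgy Hpos.
  assert (r0 := cond_pos r).
  set (c := G x0 y0).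
  assert (mono : forall x y y', Rabs (x - x0) < r -> y0 - r < y -> y < y' ->
            y' < y0 + r -> G x y < G x y').
  { intros x y y' Hx H1 H2 H3.
    apply (incr_function (G x) (y0 - r) (y0 + r) (Gy x)); simpl; auto;
      intros z Hz1 Hz2; destruct (Hr x z Hx) as [(_ & D & _) P]; auto;
      apply Rabs_lt_intro; lra. }
  assert (contx : forall x y, Rabs (x - x0) < r -> Rabs (y - y0) < r ->
            continuous (fun z => G z y) x).
  { intros x y Hx Hy. apply (@ex_derive_continuous R_AbsRing R_NormedModule).
    eexists. apply (Hr x y Hx Hy). }
  assert (conty : forall x y, Rabs (x - x0) < r -> Rabs (y - y0) < r ->
            continuous (G x) y).
  { intros x y Hx Hy. apply (@ex_derive_continuous R_AbsRing R_NormedModule).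
    eexists. apply (Hr x y Hx Hy). }
  assert (bracket : forall x1 y1 h, Rabs (x1 - x0) < r -> 0 < h ->
     y0 - r < y1 - h -> y1 + h < y0 + r -> G x1 y1 = c ->
     locally x1 (fun x => Rabs (x - x0) < r /\ G x (y1 - h) < c < G x (y1 + h))).
  { intros x1 y1 h Hx Hh Ha Hb E.
    assert (H1 : G x1 (y1 - h) < c) by (rewrite <- E; apply mono; lra || auto).
    assert (H2 : c < G x1 (y1 + h)) by (rewrite <- E; apply mono; lra || auto).
    apply filter_and; [now apply locally_near|]; apply filter_and.
    - apply (locally_comp (fun x => G x (y1 - h)) x1 (fun z => z < c)).
      + apply contx; [exact Hx|apply Rabs_lt_intro; lra].
      + now apply open_lt.
    - apply (locally_comp (fun x => G x (y1 + h)) x1 (fun z => c < z)).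
      + apply contx; [exact Hx|apply Rabs_lt_intro; lra].
      + now apply open_gt. }
  set (Q := fun x y => Rabs (y - y0) < r /\ G x y = c).
  pose (f := fun x => epsilon (inhabits 0) (Q x)).
  assert (solvable : locally x0 (fun x => Rabs (x - x0) < r /\ Q x (f x))).
  { assert (Hx0 : Rabs (x0 - x0) < r) by (apply Rabs_lt_intro; lra).
    generalize (bracket x0 y0 (r / 2) Hx0 ltac:(lra) ltac:(lra) ltac:(lra)
                  eq_refl).
    apply filter_imp. intros x [Hx Hb]. split; [exact Hx|].
    unfold f. apply epsilon_spec.
    assert (lim : forall y, Rabs (y - y0) < r -> is_lim (G x) y (G x y)).
    { intros y Hy. apply is_lim_continuity, continuity_pt_filterlim.
      now apply conty. }
    destruct (IVT_Rbar_incr (G x) (y0 - r / 2) (y0 + r / 2)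
      (G x (y0 - r / 2)) (G x (y0 + r / 2)) c) as (y & Hy1 & Hy2 & Hy3).
    - apply lim, Rabs_lt_intro; lra.
    - apply lim, Rabs_lt_intro; lra.
    - simpl. intros y Hy1 Hy2. apply continuity_pt_filterlim, conty; auto.
      apply Rabs_lt_intro; lra.
    - simpl; lra.
    - exact Hb.
    - simpl in Hy1, Hy2. exists y. split; [apply Rabs_lt_intro; lra|exact Hy3]. }
  assert (uniq : forall x y, Rabs (x - x0) < r -> Q x y -> Q x (f x) -> f x = y).
  { intros x y Hx [Hy Ey] [Hf Ef].
    apply Rabs_lt_elim in Hy. apply Rabs_lt_elim in Hf.
    destruct (Rtotal_order (f x) y) as [Hlt|[Heq|Hlt]]; [|exact Heq|].
    - assert (G x (f x) < G x y) by (apply mono; lra || auto). lra.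
    - assert (G x y < G x (f x)) by (apply mono; lra || auto). lra. }
  exists f. split.
  { destruct (locally_singleton _ _ solvable) as [Hx HQ].
    apply uniq; auto. split; [|reflexivity]. apply Rabs_lt_intro; lra. }
  generalize (locally_locally _ _ solvable). apply filter_imp.
  intros x1 L. destruct (locally_singleton _ _ L) as [Hx [Hy E]].
  split; [exact E|].
  assert (Hcont : continuous f x1).
  { apply filterlim_locally. intros eps.
    assert (eps0 := cond_pos eps).
    apply Rabs_lt_elim in Hy.
    pose (h := Rmin (eps / 2) (Rmin ((f x1 - (y0 - r)) / 2) ((y0 + r - f x1) / 2))).
    assert (Hh : 0 < h) by (unfold h; repeat apply Rmin_glb_lt; lra).
    assert (Hh1 : h <= eps / 2) by apply Rmin_l.
    assert (Hh2 : h <= (f x1 - (y0 - r)) / 2)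
      by (eapply Rle_trans; [apply Rmin_r|apply Rmin_l]).
    assert (Hh3 : h <= (y0 + r - f x1) / 2)
      by (eapply Rle_trans; [apply Rmin_r|apply Rmin_r]).
    generalize (filter_and _ _ L
      (bracket x1 (f x1) h Hx Hh ltac:(lra) ltac:(lra) E)).
    apply filter_imp. intros x [[Hxr [Hfx Efx]] [_ [B1 B2]]].
    apply Rabs_lt_elim in Hfx.
    assert (f x1 - h < f x).
    { apply Rnot_le_lt. intros [Hle|Hle].
      - assert (G x (f x) < G x (f x1 - h)) by (apply mono; lra || auto). lra.
      - rewrite <- Hle in B1. lra. }
    assert (f x < f x1 + h).
    { apply Rnot_le_lt. intros [Hle|Hle].
      - assert (G x (f x1 + h) < G x (f x)) by (apply mono; lra || auto). lra.
      - rewrite Hle in B2. lra. }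
    change (Rabs (f x - f x1) < eps). apply Rabs_lt_intro. lra. }
  destruct (Hr x1 (f x1) Hx Hy) as [(_ & Dy & Cx & _) Py].
  apply (is_derive_level_curve G); auto.
  - apply differentiable_of_partials; auto.
    destruct (locally_near _ _ _ Hx) as [d1 H1].
    destruct (locally_near _ _ _ Hy) as [d2 H2].
    exists (mkposreal _ (Rmin_stable_in_posreal d1 d2)). simpl.
    intros x y Hd1 Hd2. apply (Hr x y).
    + apply H1. eapply Rlt_le_trans; [exact Hd1|apply Rmin_l].
    + apply H2. eapply Rlt_le_trans; [exact Hd2|apply Rmin_r].
  - generalize L. apply filter_imp. intros x [_ [_ Ex]]. now rewrite E.
Qed.

Lemma implicit_function (G Gx Gy : R -> R -> R) (x0 y0 : R) :
  locally_2d (fun x y =>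
    is_derive (fun z => G z y) x (Gx x y) /\
    is_derive (fun z => G x z) y (Gy x y) /\
    continuity_2d_pt Gx x y /\ continuity_2d_pt Gy x y) x0 y0 ->
  Gy x0 y0 <> 0 ->
  exists f : R -> R, f x0 = y0 /\
    locally x0 (fun x => G x (f x) = G x0 y0 /\
                         is_derive f x (- Gx x (f x) / Gy x (f x))).
Proof.
  intros Hreg Hne.
  destruct (Rlt_le_dec 0 (Gy x0 y0)) as [Hp|Hp].
  { now apply implicit_function_pos. }
  destruct (implicit_function_pos (fun x y => - G x y) (fun x y => - Gx x y)
    (fun x y => - Gy x y) x0 y0) as (f & H0 & H1).
  - revert Hreg. apply locally_2d_impl, locally_2d_forall.
    intros x y (H1 & H2 & H3 & H4). split; [|split; [|split]].
    + now apply (@is_derive_opp R_AbsRing R_NormedModule).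
    + now apply (@is_derive_opp R_AbsRing R_NormedModule).
    + now apply continuity_2d_pt_opp.
    + now apply continuity_2d_pt_opp.
  - lra.
  - exists f. split; [exact H0|]. revert H1. apply filter_imp.
    intros x [H1 H2]. split; [lra|].
    replace (- Gx x (f x) / Gy x (f x)) with (- - Gx x (f x) / - Gy x (f x)).
    + exact H2.
    + unfold Rdiv. rewrite Rinv_opp. ring.
Qed.

Lemma is_derive_primitive (f : R -> R) (x0 : R) :
  locally x0 (fun x => continuous f x) ->
  locally x0 (fun x => is_derive (RInt f x0) x (f x)).
Proof.
  intros [d Hd]. exists d. intros x Hx.
  assert (Hx' : Rabs (x - x0) < d) by exact Hx.
  apply (is_derive_RInt f (RInt f x0) x0 x); [|now apply Hd].
  generalize (locally_near _ _ _ Hx'). apply filter_imp. intros z Hz.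
  apply (@RInt_correct R_CompleteNormedModule), ex_RInt_continuous.
  intros s Hs. apply Hd. change (Rabs (s - x0) < d).
  apply Rabs_lt_elim in Hz. apply Rabs_lt_intro.
  unfold Rmin, Rmax in Hs. destruct (Rle_dec x0 z); lra.
Qed.

(** Separation of variables: the solution is the inverse of the primitive of
    1/g, that is, an implicit function. *)
Lemma autonomous_ode (g : R -> R) (x0 : R) :
  locally x0 (fun x => continuous g x) -> g x0 <> 0 ->
  exists x : R -> R, x 0 = x0 /\ locally 0 (fun t => is_derive x t (g (x t))).
Proof.
  intros Hc Hg.
  assert (Hnz : locally x0 (fun x => continuous g x /\ g x <> 0)).
  { apply filter_and; [exact Hc|].
    apply (locally_comp g x0 (fun z => z <> 0)).
    - exact (locally_singleton _ _ Hc).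
    - now apply open_neq. }
  assert (Hinv : locally x0 (fun x => continuous (fun z => / g z) x)).
  { revert Hnz. apply filter_imp. intros x [H1 H2].
    apply (continuous_comp g Rinv); [exact H1|].
    apply continuity_pt_filterlim, continuity_pt_inv.
    - apply continuity_pt_id.
    - exact H2. }
  pose proof (is_derive_primitive _ _ Hinv) as Hp.
  destruct (implicit_function (fun t y => RInt (fun z => / g z) x0 y - t)
    (fun _ _ => -1) (fun _ y => / g y) 0 x0) as (x & Hx0 & Hx).
  - destruct (filter_and _ _ Hinv Hp) as [d Hd]. exists d. intros t y _ Hy.
    destruct (Hd y Hy) as [H1 H2]. split; [|split; [|split]].
    + auto_derive; [exact I|ring].
    + replace (/ g y) with (/ g y - 0) by ring.
      apply (@is_derive_minus R_AbsRing R_NormedModule); [exact H2|].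
      apply (@is_derive_const R_AbsRing R_NormedModule).
    + apply continuity_2d_pt_const.
    + apply (continuity_1d_2d_pt_comp (fun y => / g y) (fun _ y => y)).
      * now apply continuity_pt_filterlim.
      * apply continuity_2d_pt_id2.
  - now apply Rinv_neq_0_compat.
  - exists x. split; [exact Hx0|]. 
    assert (Hcx : continuous x 0).
    { apply (@ex_derive_continuous R_AbsRing R_NormedModule).
      eexists. apply (locally_singleton _ _ Hx). }
    rewrite <- Hx0 in Hnz.
    generalize (filter_and _ _ Hx (locally_comp _ _ _ Hcx Hnz)).
    apply filter_imp. intros t [[_ H1] [_ H2]].
    replace (g (x t)) with (- -1 / / g (x t)); [exact H1|].
    field. exact H2.
Qed.

(** * The slope metric along a graph *)

(** The norm in alpha of the graph velocity (1, w). *)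
Definition graph_alpha (m : R -> R) (u w : R) : R :=
  sqrt (1 + Derive m u ^ 2 + m u ^ 2 * w ^ 2).

(** The partial derivative dF/d(dv) at the velocity (e, e w), divided by [e]; it
    is homogeneous of degree 0, so at unit speed it is the momentum of v. *)
Definition clairaut (m : R -> R) (e u w : R) : R :=
  m u ^ 2 * w * (graph_alpha m u w - 2 * e) / (graph_alpha m u w - e) ^ 2.

(** 1 / F (e, e w): the factor that gives the velocity (e, e w) unit length. *)
Definition clock_rate (m : R -> R) (e u w : R) : R :=
  (graph_alpha m u w - e) / graph_alpha m u w ^ 2.

Lemma graph_alpha_sqr (m : R -> R) (u w : R) :
  graph_alpha m u w ^ 2 = 1 + Derive m u ^ 2 + m u ^ 2 * w ^ 2.
Proof. unfold graph_alpha. rewrite pow2_sqrt; [reflexivity|]. nra. Qed.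

Lemma graph_alpha_pos (m : R -> R) (u w : R) : 0 < graph_alpha m u w.
Proof. apply sqrt_lt_R0. nra. Qed.

Lemma alpha_graph (m : R -> R) (u v e r w : R) :
  e ^ 2 = 1 -> 0 < r -> alpha m u v (e * r) (w * (e * r)) = r * graph_alpha m u w.
Proof.
  intros He Hr. unfold alpha, graph_alpha.
  replace ((1 + Derive m u ^ 2) * (e * r) ^ 2 + m u ^ 2 * (w * (e * r)) ^ 2)
    with (r ^ 2 * (1 + Derive m u ^ 2 + m u ^ 2 * w ^ 2)).
  - rewrite sqrt_mult by nra. rewrite sqrt_pow2; lra.
  - replace ((e * r) ^ 2) with (e ^ 2 * r ^ 2) by ring.
    replace ((w * (e * r)) ^ 2) with (e ^ 2 * r ^ 2 * w ^ 2) by ring.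
    rewrite He. ring.
Qed.

Lemma smooth_derivatives (D : R -> Prop) (f : R -> R) (x : R) :
  smooth D f -> D x ->
  is_derive f x (Derive f x) /\
  is_derive (Derive f) x (Derive (Derive f) x) /\
  continuous (Derive (Derive f)) x.
Proof.
  intros Hf Hx. split; [|split].
  - exact (Derive_correct _ _ (Hf x Hx 1%nat)).
  - exact (Derive_correct _ _ (Hf x Hx 2%nat)).
  - apply (@ex_derive_continuous R_AbsRing R_NormedModule).
    exact (Hf x Hx 3%nat).
Qed.

Lemma is_derive_graph_alpha (m w : R -> R) (u w1 : R) :
  ex_derive m u -> ex_derive (Derive m) u -> is_derive w u w1 ->
  is_derive (fun z => graph_alpha m z (w z)) u
    ((Derive m u * Derive (Derive m) u + m u * Derive m u * w u ^ 2
      + m u ^ 2 * w u * w1) / graph_alpha m u (w u)).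
Proof.
  intros H1 H2 H3. pose proof (graph_alpha_pos m u (w u)) as HA.
  unfold graph_alpha in *.
  auto_derive.
  - repeat split; auto.
    + now exists w1.
    + pose proof (pow2_ge_0 (Derive m u)). pose proof (pow2_ge_0 (m u * w u)).
      nra.
  - replace (Derive (fun x => w x) u) with w1
      by (symmetry; now apply is_derive_unique).
    change (Derive (fun x => m x) u) with (Derive m u).
    change (Derive (fun x => Derive m x) u) with (Derive (Derive m) u).
    replace (1 + Derive m u * (Derive m u * 1) + m u * (m u * 1) * (w u * (w u * 1)))
      with (1 + Derive m u ^ 2 + m u ^ 2 * w u ^ 2) by ring.
    field. lra.
Qed.

(** The three partial derivatives of the energy differ only in the inner
    derivatives of alpha^2 and beta, so one chain rule serves them all. *)
Lemma is_derive_slope_energy (N B : R -> R) (x N1 B1 : R) :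
  is_derive N x N1 -> is_derive B x B1 -> 0 < N x -> sqrt (N x) - B x <> 0 ->
  is_derive (fun z => (sqrt (N z) ^ 2 / (sqrt (N z) - B z)) ^ 2 / 2) x
    (sqrt (N x) ^ 2 / (sqrt (N x) - B x)
     * ((sqrt (N x) - 2 * B x) * (N1 / 2) + sqrt (N x) ^ 2 * B1)
     / (sqrt (N x) - B x) ^ 2).
Proof.
  intros HN HB Hpos Hne. pose proof (sqrt_lt_R0 _ Hpos) as HA.
  auto_derive.
  - repeat split; auto; eexists; eassumption.
  - replace (Derive (fun x => N x) x) with N1
      by (symmetry; now apply is_derive_unique).
    replace (Derive (fun x => B x) x) with B1
      by (symmetry; now apply is_derive_unique).
    field. split; lra.
Qed.

Section Partials.
Context (m : R -> R) (u v du dv : R).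
Let N := (1 + Derive m u ^ 2) * du ^ 2 + m u ^ 2 * dv ^ 2.
Let A := alpha m u v du dv.

Lemma E_du_slope : 0 < N -> A - du <> 0 ->
  E_du (slope m) u v du dv
  = slope m u v du dv * ((A - 2 * du) * ((1 + Derive m u ^ 2) * du) + A ^ 2)
    / (A - du) ^ 2.
Proof.
  intros Hpos Hne. apply is_derive_unique.
  evar_last.
  - apply (is_derive_slope_energy
      (fun z => (1 + Derive m u ^ 2) * z ^ 2 + m u ^ 2 * dv ^ 2) (fun z => z)
      du ((1 + Derive m u ^ 2) * (2 * du)) 1).
    + auto_derive; [exact I|ring].
    + apply (@is_derive_id R_AbsRing).
    + exact Hpos.
    + exact Hne.
  - fold N. change (sqrt N) with A. unfold slope, beta. fold A. field. exact Hne.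
Qed.

Lemma E_dv_slope : 0 < N -> A - du <> 0 ->
  E_dv (slope m) u v du dv
  = slope m u v du dv * ((A - 2 * du) * (m u ^ 2 * dv)) / (A - du) ^ 2.
Proof.
  intros Hpos Hne. apply is_derive_unique.
  evar_last.
  - apply (is_derive_slope_energy
      (fun z => (1 + Derive m u ^ 2) * du ^ 2 + m u ^ 2 * z ^ 2) (fun _ => du)
      dv (m u ^ 2 * (2 * dv)) 0).
    + auto_derive; [exact I|ring].
    + apply (@is_derive_const R_AbsRing R_NormedModule).
    + exact Hpos.
    + exact Hne.
  - fold N. change (sqrt N) with A. unfold slope, beta. fold A. field. exact Hne.
Qed.

Lemma E_u_slope : 0 < N -> A - du <> 0 ->
  ex_derive m u -> ex_derive (Derive m) u ->
  E_u (slope m) u v du dv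
  = slope m u v du dv
    * ((A - 2 * du) * (Derive m u * Derive (Derive m) u * du ^ 2
                       + m u * Derive m u * dv ^ 2)) / (A - du) ^ 2.
Proof.
  intros Hpos Hne H1 H2. apply is_derive_unique.
  evar_last.
  - apply (is_derive_slope_energy
      (fun z => (1 + Derive m z ^ 2) * du ^ 2 + m z ^ 2 * dv ^ 2) (fun _ => du)
      u (2 * (Derive m u * Derive (Derive m) u * du ^ 2
              + m u * Derive m u * dv ^ 2)) 0).
    + auto_derive; [tauto|].
      change (Derive (fun x => m x) u) with (Derive m u).
      change (Derive (fun x => Derive m x) u) with (Derive (Derive m) u).
      ring.
    + apply (@is_derive_const R_AbsRing R_NormedModule).
    + exact Hpos.
    + exact Hne.
  - fold N. change (sqrt N) with A. unfold slope, beta. fold A. field. exact Hne.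
Qed.

Lemma E_v_slope : E_v (slope m) u v du dv = 0.
Proof. exact (Derive_const (energy (slope m) u v du dv) v). Qed.

End Partials.

(** * Solving the Clairaut relation *)

Definition clairaut_u (m : R -> R) (e u w : R) : R :=
  let A := graph_alpha m u w in
  2 * m u * Derive m u * w * (A - 2 * e) * / (A - e) ^ 2
  + m u ^ 2 * w * (3 * e - A) * / (A - e) ^ 3
    * (Derive m u * Derive (Derive m) u + m u * Derive m u * w ^ 2) * / A.

Definition clairaut_w (m : R -> R) (e u w : R) : R :=
  let A := graph_alpha m u w in
  m u ^ 2 * (A * (2 * e ^ 2 + 1 + Derive m u ^ 2) - 3 * e * (1 + Derive m u ^ 2))
  * / (A * (A - e) ^ 3).

Lemma is_derive_clairaut_u (m : R -> R) (e u w : R) :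
  ex_derive m u -> ex_derive (Derive m) u -> graph_alpha m u w <> e ->
  is_derive (fun z => clairaut m e z w) u (clairaut_u m e u w).
Proof.
  intros H1 H2 Hne. pose proof (graph_alpha_pos m u w) as HA.
  assert (D := is_derive_graph_alpha m (fun _ => w) u 0 H1 H2
                 (is_derive_const w u)).
  cbv beta in D. unfold clairaut, clairaut_u. cbv zeta.
  auto_derive.
  - repeat split; auto.
    + eexists; exact D.
    + eexists; exact D.
    + intros E. apply Hne. nra.
  - replace (Derive (fun x => graph_alpha m x w) u) with
      ((Derive m u * Derive (Derive m) u + m u * Derive m u * w ^ 2
        + m u ^ 2 * w * 0) / graph_alpha m u w)
      by (symmetry; now apply is_derive_unique).
    change (Derive (fun x => m x) u) with (Derive m u).
    field. split; lra.
Qed.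

Lemma is_derive_clairaut_w (m : R -> R) (e u w : R) :
  graph_alpha m u w <> e ->
  is_derive (fun z => clairaut m e u z) w (clairaut_w m e u w).
Proof.
  intros Hne. pose proof (graph_alpha_pos m u w) as HA.
  pose proof (graph_alpha_sqr m u w) as HS.
  assert (D : is_derive (fun z => graph_alpha m u z) w
                (m u ^ 2 * w / graph_alpha m u w)).
  { unfold graph_alpha in *. auto_derive.
    - pose proof (pow2_ge_0 (Derive m u)). pose proof (pow2_ge_0 (m u * w)). nra.
    - replace (1 + Derive m u * (Derive m u * 1) + m u * (m u * 1) * (w * (w * 1)))
        with (1 + Derive m u ^ 2 + m u ^ 2 * w ^ 2) by ring.
      field. lra. }
  unfold clairaut, clairaut_w. cbv zeta.
  auto_derive.
  - repeat split; auto.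
    + eexists; exact D.
    + eexists; exact D.
    + intros E. apply Hne. nra.
  - replace (Derive (fun x => graph_alpha m u x) w) with
      (m u ^ 2 * w / graph_alpha m u w) by (symmetry; now apply is_derive_unique).
    set (A := graph_alpha m u w) in *. set (p := Derive m u) in *.
    replace (A * (2 * e ^ 2 + 1 + p ^ 2) - 3 * e * (1 + p ^ 2))
      with ((A - 2 * e) * (A - e) * A + (3 * e - A) * (A ^ 2 - (1 + p ^ 2)))
      by ring.
    rewrite HS. field. split; lra.
Qed.

(** Since e^2 = 1, the middle factor is A (3 + p^2) - 3 e (1 + p^2), and the
    bound A > 3 lets its first term dominate. *)
Lemma clairaut_w_pos (m : R -> R) (e u w : R) :
  e = 1 \/ e = -1 -> 0 < m u -> 3 < graph_alpha m u w ->
  0 < clairaut_w m e u w.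
Proof.
  intros He Hm HA. unfold clairaut_w. set (A := graph_alpha m u w) in *.
  pose proof (pow2_ge_0 (Derive m u)).
  apply Rmult_lt_0_compat.
  - apply Rmult_lt_0_compat; [nra|]. destruct He; subst e; nra.
  - apply Rinv_0_lt_compat, Rmult_lt_0_compat; [lra|].
    apply pow_lt. destruct He; lra.
Qed.

Lemma open_open_itv (a b : Rbar) : open (open_itv a b).
Proof. apply open_and; [apply open_Rbar_gt|apply open_Rbar_lt]. Qed.

Lemma locally_2d_fst (P : R -> Prop) (x y : R) :
  locally x P -> locally_2d (fun a _ => P a) x y.
Proof. intros [d Hd]. exists d. intros a b Ha _. now apply Hd. Qed.

Lemma continuity_2d_fst (f : R -> R) (x y : R) :
  continuous f x -> continuity_2d_pt (fun a _ => f a) x y.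
Proof.
  intros Hf. apply (continuity_1d_2d_pt_comp f (fun a _ => a)).
  - now apply continuity_pt_filterlim.
  - apply continuity_2d_pt_id1.
Qed.

Lemma continuity_2d_pow (f : R -> R -> R) (n : nat) (x y : R) :
  continuity_2d_pt f x y -> continuity_2d_pt (fun a b => f a b ^ n) x y.
Proof.
  intros Hf. induction n as [|n IH]; simpl.
  - apply continuity_2d_pt_const.
  - now apply continuity_2d_pt_mult.
Qed.

Lemma continuity_2d_graph_alpha (m : R -> R) (u w : R) :
  continuous m u -> continuous (Derive m) u ->
  continuity_2d_pt (graph_alpha m) u w.
Proof.
  intros H1 H2.
  apply (continuity_1d_2d_pt_comp sqrt
    (fun a b => 1 + Derive m a ^ 2 + m a ^ 2 * b ^ 2)).
  - apply continuity_pt_sqrt. nra.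
  - repeat apply continuity_2d_pt_plus;
      repeat apply continuity_2d_pt_mult; 
      try apply continuity_2d_pow;
      auto using continuity_2d_fst, continuity_2d_pt_const, continuity_2d_pt_id2.
Qed.

Ltac continuity_2d_tac :=
  unfold Rminus;
  repeat (apply continuity_2d_pt_plus || apply continuity_2d_pt_mult
          || apply continuity_2d_pow || apply continuity_2d_pt_opp);
  auto using continuity_2d_fst, continuity_2d_pt_const, continuity_2d_pt_id2.

Lemma clairaut_level_curve (lo hi : Rbar) (m : R -> R) (e u0 w0 : R) :
  smooth (open_itv lo hi) m -> (forall u, open_itv lo hi u -> 0 < m u) ->
  e = 1 \/ e = -1 -> open_itv lo hi u0 -> 3 < graph_alpha m u0 w0 ->
  exists w : R -> R, w u0 = w0 /\ locally u0 (fun u =>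
    clairaut m e u (w u) = clairaut m e u0 w0 /\
    is_derive w u (- clairaut_u m e u (w u) / clairaut_w m e u (w u))).
Proof.
  intros Hsm Hpos He Hu0 HA0.
  assert (reg : forall u, open_itv lo hi u -> continuous m u /\
     continuous (Derive m) u /\ continuous (Derive (Derive m)) u /\
     ex_derive m u /\ ex_derive (Derive m) u).
  { intros u Hu. destruct (smooth_derivatives _ _ _ Hsm Hu) as (D1 & D2 & C).
    split; [|split; [|split; [exact C|split; eexists; eassumption]]].
    all: apply (@ex_derive_continuous R_AbsRing R_NormedModule);
      eexists; eassumption. }
  apply (implicit_function (clairaut m e) (clairaut_u m e) (clairaut_w m e)).
  2: { pose proof (clairaut_w_pos m e u0 w0 He (Hpos _ Hu0) HA0). lra. }
  assert (Hbig : locally_2d (fun u w => 3 < graph_alpha m u w) u0 w0).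
  { destruct (reg u0 Hu0) as (C0 & C1 & _).
    assert (Hd : 0 < graph_alpha m u0 w0 - 3) by lra.
    destruct (continuity_2d_graph_alpha m u0 w0 C0 C1 (mkposreal _ Hd))
      as [d Hd']. exists d. intros u w Hu Hw. specialize (Hd' u w Hu Hw).
    apply Rabs_lt_elim in Hd'. simpl in Hd'. lra. }
  assert (Hin := locally_2d_fst _ u0 w0 (open_open_itv lo hi u0 Hu0)).
  generalize (locally_2d_and _ _ _ _ Hin Hbig).
  apply locally_2d_impl, locally_2d_forall. intros u w [Hu HA].
  destruct (reg u Hu) as (C0 & C1 & C2 & D1 & D2).
  assert (Hne : 0 < graph_alpha m u w - e) by (destruct He; lra).
  assert (CA := continuity_2d_graph_alpha m u w C0 C1).
  assert (CI : forall n, continuity_2d_pt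
             (fun a b => / (graph_alpha m a b - e) ^ n) u w).
  { intros n. apply continuity_2d_pt_inv; [continuity_2d_tac|].
    now apply pow_nonzero, Rgt_not_eq. }
  split; [|split; [|split]].
  - apply is_derive_clairaut_u; auto. lra.
  - apply is_derive_clairaut_w; auto. lra.
  - unfold clairaut_u; cbv zeta. continuity_2d_tac.
    apply continuity_2d_pt_inv; [exact CA|]. lra.
  - unfold clairaut_w; cbv zeta. continuity_2d_tac.
    apply (continuity_2d_pt_inv
      (fun a b => graph_alpha m a b * (graph_alpha m a b - e) ^ 3)); [continuity_2d_tac|].
    apply Rgt_not_eq, Rmult_lt_0_compat; [lra|now apply pow_lt].
Qed.

(** * Existence of slope geodesics *)

(** Homogeneity of degree 2 gives E_du u' + E_dv v' = F^2 = 1 at unit speed,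
    hence the form of E_du below: it is 1 / u' - E_dv w. *)
Lemma slope_momenta_graph (m : R -> R) (e u v w : R) :
  let A := graph_alpha m u w in
  let r := clock_rate m e u w in
  e = 1 \/ e = -1 -> 3 < A -> ex_derive m u -> ex_derive (Derive m) u ->
  E_du (slope m) u v (e * r) (w * (e * r))
    = e * A ^ 2 / (A - e) - e * clairaut m e u w * w /\
  E_dv (slope m) u v (e * r) (w * (e * r)) = e * clairaut m e u w /\
  E_u (slope m) u v (e * r) (w * (e * r))
    = r * (A - 2 * e) * (Derive m u * Derive (Derive m) u + m u * Derive m u * w ^ 2)
      / (A - e) ^ 2.
Proof.
  cbv zeta. intros He HA H1 H2.
  assert (He2 : e ^ 2 = 1) by (destruct He; subst e; ring).
  assert (HAe : 0 < graph_alpha m u w - e) by (destruct He; lra).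
  assert (Hr : 0 < clock_rate m e u w).
  { unfold clock_rate. apply Rdiv_lt_0_compat; [lra|]. apply pow_lt; lra. }
  assert (Ha := alpha_graph m u v e (clock_rate m e u w) w He2 Hr).
  assert (HS := graph_alpha_sqr m u w).
  assert (Hr' : clock_rate m e u w * graph_alpha m u w ^ 2
                = graph_alpha m u w - e) by (unfold clock_rate; field; lra).
  unfold clairaut.
  set (A := graph_alpha m u w) in *. set (r := clock_rate m e u w) in *.
  assert (HN : 0 < (1 + Derive m u ^ 2) * (e * r) ^ 2
                    + m u ^ 2 * (w * (e * r)) ^ 2).
  { replace ((1 + Derive m u ^ 2) * (e * r) ^ 2 + m u ^ 2 * (w * (e * r)) ^ 2)
      with (e ^ 2 * r ^ 2 * (1 + Derive m u ^ 2 + m u ^ 2 * w ^ 2)) by ring.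
    rewrite <- HS, He2. nra. }
  assert (Hne : alpha m u v (e * r) (w * (e * r)) - e * r <> 0)
    by (rewrite Ha; nra).
  assert (HF : slope m u v (e * r) (w * (e * r)) = 1).
  { unfold slope, beta. rewrite Ha.
    replace ((r * A) ^ 2) with (r * (r * A ^ 2)) by ring. rewrite Hr'.
    field. nra. }
  assert (Hm : m u ^ 2 * w ^ 2 = A ^ 2 - (1 + Derive m u ^ 2)) by lra.
  rewrite E_du_slope, E_dv_slope, E_u_slope by assumption.
  rewrite HF, Ha. repeat split.
  - replace (e * (m u ^ 2 * w * (A - 2 * e) / (A - e) ^ 2) * w)
      with (e * (m u ^ 2 * w ^ 2) * (A - 2 * e) / (A - e) ^ 2) by (field; lra).
    rewrite Hm.
    replace (e * A ^ 2 / (A - e)) with ((e * A ^ 3 - e ^ 2 * A ^ 2) / (A - e) ^ 2)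
      by (field; lra).
    replace (e * (A ^ 2 - (1 + Derive m u ^ 2)) * (A - 2 * e))
      with (e * A ^ 3 - e * (1 + Derive m u ^ 2) * A - 2 * e ^ 2 * A ^ 2
            + 2 * e ^ 2 * (1 + Derive m u ^ 2)) by ring.
    replace (1 * ((r * A - 2 * (e * r)) * ((1 + Derive m u ^ 2) * (e * r)) + (r * A) ^ 2)
             / (r * A - e * r) ^ 2)
      with (((A - 2 * e) * ((1 + Derive m u ^ 2) * e) + A ^ 2) / (A - e) ^ 2)
      by (field; split; nra).
    replace ((A - 2 * e) * ((1 + Derive m u ^ 2) * e))
      with (e * (1 + Derive m u ^ 2) * A - 2 * e ^ 2 * (1 + Derive m u ^ 2)) by ring.
    rewrite He2. field. lra.
  - field. split; nra.
  - replace (Derive m u * Derive (Derive m) u * (e * r) ^ 2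
             + m u * Derive m u * (w * (e * r)) ^ 2)
      with (e ^ 2 * (Derive m u * Derive (Derive m) u * r ^ 2
                    + m u * Derive m u * w ^ 2 * r ^ 2)) by ring.
    rewrite He2. field. split; nra.
Qed.

Lemma open_itv_sym (d t : R) : open_itv (- d) d t <-> Rabs t < d.
Proof.
  unfold open_itv; simpl. split; intros H.
  - apply Rabs_def1; lra.
  - apply Rabs_def2 in H; lra.
Qed.

(** The equation for v is the constancy of the momentum e k.  In the equation
    for u, with E_du = e A^2 / (A - e) - e k w, the derivative of [w] cancels: the
    first term is e F (e, e w), and its derivative in w is e^2 dF/d(dv) = e k. *)
Lemma slope_geodesic_of_graph (lo hi : Rbar) (m : R -> R) (d e k : R)
    (u v w : R -> R) :
  smooth (open_itv lo hi) m -> 0 < d -> e = 1 \/ e = -1 ->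
  (forall t, Rabs t < d ->
     let r := clock_rate m e (u t) (w (u t)) in
     open_itv lo hi (u t) /\ 3 < graph_alpha m (u t) (w (u t)) /\
     clairaut m e (u t) (w (u t)) = k /\ ex_derive w (u t) /\
     is_derive u t (e * r) /\ is_derive v t (w (u t) * (e * r))) ->
  geodesic lo hi m (slope m) (- d) d (fun t => rev_param m (u t, v t)).
Proof.
  cbv zeta. intros Hsm Hd He H. split; [simpl; lra|]. exists u, v.
  intros t Ht. apply open_itv_sym in Ht.
  set (r := fun x => clock_rate m e x (w x)) in *.
  assert (Hloc : locally t (fun s => Rabs s < d)).
  { replace t with (t - 0) in Ht by ring.
    generalize (locally_near 0 d t Ht). apply filter_imp.
    intros s. now rewrite Rminus_0_r. }
  assert (Hu : forall s, Rabs s < d -> Derive u s = e * r (u s)).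
  { intros s Hs. now apply is_derive_unique, H. }
  assert (Hv : forall s, Rabs s < d -> Derive v s = w (u s) * (e * r (u s))).
  { intros s Hs. now apply is_derive_unique, H. }
  assert (reg : forall s, Rabs s < d -> ex_derive m (u s) /\ ex_derive (Derive m) (u s)).
  { intros s Hs. destruct (H s Hs) as [Is _].
    destruct (smooth_derivatives _ _ _ Hsm Is) as (D1 & D2 & _).
    split; eexists; eassumption. }
  assert (mom := fun s (Hs : Rabs s < d) =>
    slope_momenta_graph m e (u s) (v s) (w (u s)) He
      (proj1 (proj2 (H s Hs))) (proj1 (reg s Hs)) (proj2 (reg s Hs))).
  cbv zeta in mom.
  destruct (H t Ht) as (It & HA & Hk & [w1 Hw1] & Dut & Dvt).
  fold (r (u t)) in Dut, Dvt.
  destruct (reg t Ht) as [R1 R2].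
  assert (DA := is_derive_graph_alpha m w (u t) w1 R1 R2 Hw1).
  set (A := fun x => graph_alpha m x (w x)) in *.
  fold (A (u t)) in DA, HA.
  assert (HAe : 0 < A (u t) - e) by (destruct He; lra).
  assert (Dr : ex_derive r (u t)).
  { apply (ex_derive_comp (fun y => (y - e) / y ^ 2) A); [|eexists; exact DA].
    auto_derive. nra. }
  assert (Du2 : ex_derive (fun s => r (u s)) t).
  { apply (ex_derive_comp r u); [exact Dr|eexists; exact Dut]. }
  assert (Hrpos : 0 < r (u t)).
  { unfold r, clock_rate. apply Rdiv_lt_0_compat; [exact HAe|].
    apply pow_lt, graph_alpha_pos. }
  split; [exact It|]. split; [reflexivity|].
  split; [eexists; exact Dut|]. split; [eexists; exact Dvt|].
  split.
  { apply (ex_derive_ext_loc (fun s => e * r (u s))).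
    - revert Hloc. apply filter_imp. intros s Hs. symmetry. now apply Hu.
    - apply (ex_derive_scal (fun s => r (u s)) e t). exact Du2. }
  split.
  { apply (ex_derive_ext_loc (fun s => w (u s) * (e * r (u s)))).
    - revert Hloc. apply filter_imp. intros s Hs. symmetry. now apply Hv.
    - apply (ex_derive_mult (fun s => w (u s)) (fun s => e * r (u s))).
      + apply (ex_derive_comp w u); eexists; eassumption.
      + apply (ex_derive_scal (fun s => r (u s)) e t). exact Du2. }
  split.
  { rewrite Hu by exact Ht. intros E. injection E as E _.
    destruct He; subst e; lra. }
  split.
  - apply (is_derive_ext_loc (fun s => e * A (u s) ^ 2 / (A (u s) - e) - e * k * w (u s))).
    + revert Hloc. apply filter_imp. intros s Hs.
      rewrite (Hu s Hs), (Hv s Hs). destruct (mom s Hs) as [E _].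
      unfold r. rewrite E. destruct (H s Hs) as (_ & _ & Ek & _).
      now rewrite Ek.
    + rewrite (Hu t Ht), (Hv t Ht). destruct (mom t Ht) as (_ & _ & E).
      unfold r at 1 2. rewrite E. clear E.
      evar_last.
      * apply (is_derive_comp (fun x => e * A x ^ 2 / (A x - e) - e * k * w x) u);
          [|exact Dut].
        apply (@is_derive_minus R_AbsRing R_NormedModule);
          [|apply is_derive_scal; exact Hw1].
        apply (is_derive_comp (fun y => e * y ^ 2 / (y - e)) A); [|exact DA].
        auto_derive; [lra|reflexivity].
      * fold (A (u t)). fold (r (u t)). unfold scal, minus, plus, opp; simpl.
        unfold mult; simpl.
        rewrite <- Hk. unfold clairaut. fold (A (u t)).
        destruct He; subst e; field; lra.
  - rewrite E_v_slope.
    apply (is_derive_ext_loc (fun _ => e * k)).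
    + revert Hloc. apply filter_imp. intros s Hs.
      rewrite (Hu s Hs), (Hv s Hs). destruct (mom s Hs) as (_ & E & _).
      unfold r. rewrite E. destruct (H s Hs) as (_ & _ & Ek & _).
      now rewrite Ek.
    + apply (@is_derive_const R_AbsRing R_NormedModule).
Qed.

(** The value given for the derivative of [w] at u0 is what the two
    impossibility proofs use: it depends on the initial direction and on [e]
    only.  Shorter geodesics are included because flatness concerns those that
    stay in a coordinate domain. *)
Lemma slope_geodesic_exists (lo hi : Rbar) (m : R -> R) (e u0 w0 : R) :
  smooth (open_itv lo hi) m -> (forall u, open_itv lo hi u -> 0 < m u) ->
  e = 1 \/ e = -1 -> open_itv lo hi u0 -> 3 < graph_alpha m u0 w0 ->
  exists (u v w : R -> R) (d : R),
    0 < d /\ u 0 = u0 /\ v 0 = 0 /\ w u0 = w0 /\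
    is_derive w u0 (- clairaut_u m e u0 w0 / clairaut_w m e u0 w0) /\
    (forall t, Rabs t < d ->
       open_itv lo hi (u t) /\
       exists s, s <> 0 /\ is_derive u t s /\ is_derive v t (w (u t) * s)) /\
    (forall d', 0 < d' <= d ->
       geodesic lo hi m (slope m) (- d') d' (fun t => rev_param m (u t, v t))).
Proof.
  intros Hsm Hpos He Hu0 HA0.
  destruct (clairaut_level_curve lo hi m e u0 w0 Hsm Hpos He Hu0 HA0)
    as (w & Hw0 & Hw).
  pose (k := clairaut m e u0 w0).
  pose (A := fun x => graph_alpha m x (w x)).
  pose (r := fun x => clock_rate m e x (w x)).
  assert (Hw' : locally u0 (fun x => open_itv lo hi x /\
     clairaut m e x (w x) = k /\ ex_derive w x /\ ex_derive A x)).
  { generalize (filter_and _ _ (open_open_itv lo hi u0 Hu0) Hw).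
    apply filter_imp. intros x [Ix [Ek Dx]]. repeat split; auto; [apply Ix|apply Ix| |].
    - eexists; exact Dx.
    - destruct (smooth_derivatives _ _ _ Hsm Ix) as (D1 & D2 & _).
      eexists. apply (is_derive_graph_alpha m w); try (eexists; eassumption).
      exact Dx. }
  assert (HA : locally u0 (fun x => 3 < A x)).
  { apply (locally_comp A u0 (fun z => 3 < z)).
    - apply (@ex_derive_continuous R_AbsRing R_NormedModule).
      apply (locally_singleton _ _ Hw').
    - apply open_gt. unfold A. now rewrite Hw0. }
  assert (Hall := filter_and _ _ Hw' HA).
  assert (Hr : locally u0 (fun x => continuous r x /\ 0 < r x)).
  { revert Hall. apply filter_imp. intros x [(_ & _ & _ & DA) H3].
    fold (A x) in H3. split.
    - apply (@ex_derive_continuous R_AbsRing R_NormedModule).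
      apply (ex_derive_comp (fun y => (y - e) / y ^ 2) A); [|exact DA].
      auto_derive. nra.
    - unfold r, clock_rate. apply Rdiv_lt_0_compat.
      + fold (A x). destruct He; lra.
      + apply pow_lt, graph_alpha_pos. }
  destruct (autonomous_ode (fun x => e * r x) u0) as (u & Hu00 & Hu).
  { revert Hr. apply filter_imp. intros x [Hc _].
    apply (continuous_scal_r (K:=R_AbsRing) (V:=R_NormedModule) e r). exact Hc. }
  { apply locally_singleton in Hr. destruct He; subst e; lra. }
  assert (Hp : locally u0 (fun x => is_derive (RInt w u0) x (w x))).
  { apply is_derive_primitive. revert Hw'. apply filter_imp.
    intros x (_ & _ & Dx & _).
    now apply (@ex_derive_continuous R_AbsRing R_NormedModule). }
  assert (Hcu : continuous u 0).
  { apply (@ex_derive_continuous R_AbsRing R_NormedModule).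
    eexists. apply (locally_singleton _ _ Hu). }
  assert (Hx := filter_and _ _ Hall (filter_and _ _ Hr Hp)).
  rewrite <- Hu00 in Hx at 1.
  destruct (filter_and _ _ Hu (locally_comp _ _ _ Hcu Hx)) as [d Hd].
  assert (Hall' : forall t, Rabs t < d ->
     open_itv lo hi (u t) /\ 3 < A (u t) /\ clairaut m e (u t) (w (u t)) = k /\
     ex_derive w (u t) /\ 0 < r (u t) /\ is_derive u t (e * r (u t)) /\
     is_derive (fun t => RInt w u0 (u t)) t (w (u t) * (e * r (u t)))).
  { intros t Ht. destruct (Hd t) as [Du [[(I & Ek & Dw & _) H3] [[_ Hrp] Hp']]].
    { change (Rabs (t - 0) < d). now rewrite Rminus_0_r. }
    refine (conj I (conj H3 (conj Ek (conj Dw (conj Hrp (conj Du _)))))).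
    rewrite Rmult_comm. now apply (is_derive_comp (RInt w u0) u). }
  exists u, (fun t => RInt w u0 (u t)), w, d.
  split; [apply cond_pos|]. split; [exact Hu00|].
  split; [rewrite Hu00; exact (RInt_point u0 w)|]. split; [exact Hw0|].
  split.
  { rewrite <- Hw0. apply (locally_singleton _ _ Hw). }
  split.
  - intros t Ht. destruct (Hall' t Ht) as (I & _ & _ & _ & Hrp & Du & Dv).
    split; [exact I|]. exists (e * r (u t)).
    split; [|exact (conj Du Dv)].
    destruct He; subst e; lra.
  - intros d' Hd'. apply (slope_geodesic_of_graph lo hi m d' e k u _ w); auto.
    + lra.
    + cbv zeta. intros t Ht.
      destruct (Hall' t ltac:(lra)) as (I & H3 & Ek & Dw & _ & Du & Dv).
      exact (conj I (conj H3 (conj Ek (conj Dw (conj Du Dv))))).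
Qed.

(** * The second-order equations of the geodesics as graphs *)

(** The total derivative of the Clairaut momentum along the graph, cleared of
    denominators. *)
Lemma slope_graph_equation (m : R -> R) (e u w : R) :
  let A := graph_alpha m u w in
  let w1 := - clairaut_u m e u w / clairaut_w m e u w in
  0 < m u -> e = 1 \/ e = -1 -> 3 < A ->
  A * (A - e) * (A - 2 * e) * (2 * Derive m u * w + m u * w1)
  + m u * w * (3 * e - A) * (Derive m u * Derive (Derive m) u
      + m u * Derive m u * w ^ 2 + m u ^ 2 * w * w1) = 0.
Proof.
  cbv zeta. intros Hm He HA.
  assert (Hw := clairaut_w_pos m e u w He Hm HA).
  assert (E : clairaut_u m e u w + (- clairaut_u m e u w / clairaut_w m e u w)
                * clairaut_w m e u w = 0) by (field; lra).
  revert E. generalize (- clairaut_u m e u w / clairaut_w m e u w).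
  clear Hw. intros w1. assert (HS := graph_alpha_sqr m u w).
  unfold clairaut_u, clairaut_w. set (A := graph_alpha m u w) in *.
  assert (HAe : 0 < A - e) by (destruct He; lra).
  replace (A * (2 * e ^ 2 + 1 + Derive m u ^ 2) - 3 * e * (1 + Derive m u ^ 2))
    with ((A - 2 * e) * (A - e) * A + (3 * e - A) * (A ^ 2 - (1 + Derive m u ^ 2)))
    by ring.
  replace (A ^ 2 - (1 + Derive m u ^ 2)) with (m u ^ 2 * w ^ 2) by lra.
  intros E.
  apply (Rmult_eq_reg_l (m u * / (A * (A - e) ^ 3))).
  2: { apply Rmult_integral_contrapositive_currified; [lra|].
       apply Rinv_neq_0_compat, Rmult_integral_contrapositive_currified; [lra|].
       apply pow_nonzero; lra. }
  rewrite Rmult_0_r, <- E. field. lra.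
Qed.

Lemma energy_alpha (m : R -> R) (u v du dv : R) :
  energy (alpha m) u v du dv
  = ((1 + Derive m u ^ 2) * du ^ 2 + m u ^ 2 * dv ^ 2) / 2.
Proof. unfold energy, alpha. rewrite pow2_sqrt; [reflexivity|]. nra. Qed.

Lemma E_du_alpha (m : R -> R) (u v du dv : R) :
  E_du (alpha m) u v du dv = (1 + Derive m u ^ 2) * du.
Proof.
  unfold E_du. rewrite (Derive_ext _ _ _ (fun y => energy_alpha m u v y dv)).
  apply is_derive_unique. auto_derive; [exact I|field].
Qed.

Lemma E_dv_alpha (m : R -> R) (u v du dv : R) :
  E_dv (alpha m) u v du dv = m u ^ 2 * dv.
Proof.
  unfold E_dv. rewrite (Derive_ext _ _ _ (fun y => energy_alpha m u v du y)).
  apply is_derive_unique. auto_derive; [exact I|field].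
Qed.

Lemma E_u_alpha (m : R -> R) (u v du dv : R) :
  ex_derive m u -> ex_derive (Derive m) u ->
  E_u (alpha m) u v du dv
  = Derive m u * Derive (Derive m) u * du ^ 2 + m u * Derive m u * dv ^ 2.
Proof.
  intros H1 H2.
  unfold E_u. rewrite (Derive_ext _ _ _ (fun y => energy_alpha m y v du dv)).
  apply is_derive_unique. auto_derive; [tauto|].
  change (Derive (fun x => m x) u) with (Derive m u).
  change (Derive (fun x => Derive m x) u) with (Derive (Derive m) u).
  field.
Qed.

Lemma E_v_alpha (m : R -> R) (u v du dv : R) : E_v (alpha m) u v du dv = 0.
Proof. exact (Derive_const (energy (alpha m) u v du dv) v). Qed.

Lemma is_derive_unique2 (f : R -> R) (x a b : R) :
  is_derive f x a -> is_derive f x b -> a = b.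
Proof.
  intros Ha Hb. rewrite <- (is_derive_unique _ _ _ Ha).
  now apply is_derive_unique.
Qed.

Lemma is_derive_Rmult (f g : R -> R) (x a b : R) :
  is_derive f x a -> is_derive g x b ->
  is_derive (fun z => f z * g z) x (a * g x + f x * b).
Proof. intros Hf Hg. exact (is_derive_mult f g x a b Hf Hg Rmult_comm). Qed.

(** Lifts of one curve to the universal cover have the same velocity. *)
Lemma angle_derive_unique (f g : R -> R) (t a b : R) :
  locally t (fun s => cos (f s) = cos (g s) /\ sin (f s) = sin (g s)) ->
  is_derive f t a -> is_derive g t b -> a = b.
Proof.
  intros H Hf Hg. destruct (locally_singleton _ _ H) as [Ec Es].
  assert (C : a * - sin (f t) = b * - sin (g t)).
  { apply (is_derive_unique2 (fun s => cos (f s)) t).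
    - apply (is_derive_comp cos f); [apply is_derive_cos|exact Hf].
    - apply (is_derive_ext_loc (fun s => cos (g s))).
      + revert H. apply filter_imp. intros s [E _]. now symmetry.
      + apply (is_derive_comp cos g); [apply is_derive_cos|exact Hg]. }
  assert (S : a * cos (f t) = b * cos (g t)).
  { apply (is_derive_unique2 (fun s => sin (f s)) t).
    - apply (is_derive_comp sin f); [apply is_derive_sin|exact Hf].
    - apply (is_derive_ext_loc (fun s => sin (g s))).
      + revert H. apply filter_imp. intros s [_ E]. now symmetry.
      + apply (is_derive_comp sin g); [apply is_derive_sin|exact Hg]. }
  rewrite <- Es in C. rewrite <- Ec in S.
  assert (U := sin2_cos2 (f t)). unfold Rsqr in U.
  replace a with (a * (sin (f t) * sin (f t) + cos (f t) * cos (f t)))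
    by (rewrite U; ring).
  replace (a * (sin (f t) * sin (f t) + cos (f t) * cos (f t)))
    with (- sin (f t) * (a * - sin (f t)) + cos (f t) * (a * cos (f t))) by ring.
  rewrite C, S. transitivity (b * (sin (f t) * sin (f t) + cos (f t) * cos (f t))).
  - ring.
  - rewrite U. ring.
Qed.

Lemma rev_param_inj (m : R -> R) (u v u' v' : R) :
  0 < m u -> rev_param m (u, v) = rev_param m (u', v') ->
  u' = u /\ cos v = cos v' /\ sin v = sin v'.
Proof.
  intros Hm E. unfold rev_param in E; simpl in E. injection E as E1 E2 E3.
  subst u'. split; [reflexivity|].
  split; apply (Rmult_eq_reg_l (m u)); lra.
Qed.

(** Constancy of m^2 w u' gives m w u'' = - X u'^2, and eliminating u'' from the
    equation for u leaves a relation that is free of the parametrization. *)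
Lemma alpha_graph_equation (lo hi a b : Rbar) (m u v w : R -> R) (t w1 : R) :
  smooth (open_itv lo hi) m -> open_itv a b t ->
  (forall s, open_itv a b s ->
    open_itv lo hi (u s) /\ ex_derive u s /\
    ex_derive (Derive u) s /\ Derive u s <> 0 /\
    Derive v s = w (u s) * Derive u s /\
    is_derive (fun s => E_du (alpha m) (u s) (v s) (Derive u s) (Derive v s)) s
              (E_u (alpha m) (u s) (v s) (Derive u s) (Derive v s)) /\
    is_derive (fun s => E_dv (alpha m) (u s) (v s) (Derive u s) (Derive v s)) s
              (E_v (alpha m) (u s) (v s) (Derive u s) (Derive v s))) ->
  is_derive w (u t) w1 -> 0 < m (u t) ->
  (1 + Derive m (u t) ^ 2) * (2 * Derive m (u t) * w (u t) + m (u t) * w1)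
  = m (u t) * w (u t) * (Derive m (u t) * Derive (Derive m) (u t)
                         - m (u t) * Derive m (u t) * w (u t) ^ 2).
Proof.
  intros Hsm Ht H Hw Hm.
  destruct (H t Ht) as (It & Du & D2u & Hne & Ev & Eu' & Ev').
  destruct (smooth_derivatives _ _ _ Hsm It) as (M1 & M2 & _).
  assert (X1 := Derive_correct _ _ Du). assert (X2 := Derive_correct _ _ D2u).
  assert (Hl := open_open_itv a b t Ht).
  rewrite E_u_alpha in Eu' by (eexists; eassumption). rewrite E_v_alpha in Ev'.
  assert (F1 : is_derive (fun s => (1 + Derive m (u s) ^ 2) * Derive u s) t
     (Derive m (u t) * Derive (Derive m) (u t) * Derive u t ^ 2
      + m (u t) * Derive m (u t) * Derive v t ^ 2)).
  { revert Eu'. apply is_derive_ext. intros s. apply E_du_alpha. }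
  assert (F2 : is_derive (fun s => m (u s) ^ 2 * (w (u s) * Derive u s)) t 0).
  { revert Ev'. apply is_derive_ext_loc. revert Hl. apply filter_imp.
    intros s Hs. rewrite E_dv_alpha. f_equal. now apply H. }
  assert (C1 : is_derive (fun s => Derive m (u s)) t
                 (Derive u t * Derive (Derive m) (u t)))
    by now apply (is_derive_comp (Derive m) u).
  assert (C2 : is_derive (fun s => m (u s)) t (Derive u t * Derive m (u t)))
    by now apply (is_derive_comp m u).
  assert (C3 : is_derive (fun s => w (u s)) t (Derive u t * w1))
    by now apply (is_derive_comp w u).
  set (U := Derive u t) in *. set (UU := Derive (Derive u) t) in *.
  assert (G1 : is_derive (fun s => (1 + Derive m (u s) ^ 2) * Derive u s) t
    (2 * Derive m (u t) * (U * Derive (Derive m) (u t)) * U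
      + (1 + Derive m (u t) ^ 2) * UU)).
  { evar_last.
    - apply (is_derive_Rmult (fun s => 1 + Derive m (u s) ^ 2) (Derive u));
        [|exact X2].
      apply (@is_derive_plus R_AbsRing R_NormedModule).
      + apply (@is_derive_const R_AbsRing R_NormedModule).
      + apply is_derive_pow. exact C1.
    - unfold plus, mult, zero; simpl. fold U. ring. }
  assert (G2 : is_derive (fun s => m (u s) ^ 2 * (w (u s) * Derive u s)) t
    (2 * m (u t) * (U * Derive m (u t)) * (w (u t) * U)
      + m (u t) ^ 2 * (U * w1 * U + w (u t) * UU))).
  { evar_last.
    - apply (is_derive_Rmult (fun s => m (u s) ^ 2) (fun s => w (u s) * Derive u s)).
      + apply is_derive_pow. exact C2.
      + apply (is_derive_Rmult (fun s => w (u s)) (Derive u)); [exact C3|exact X2].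
    - unfold plus, mult; simpl. fold U. ring. }
  assert (E1 := is_derive_unique2 _ _ _ _ F1 G1).
  assert (E2 := is_derive_unique2 _ _ _ _ F2 G2).
  rewrite Ev in E1.
  set (mu := m (u t)) in *. set (p := Derive m (u t)) in *.
  set (s := Derive (Derive m) (u t)) in *. set (om := w (u t)) in *.
  clearbody mu p s om U UU.
  assert (HU2 : 0 < U ^ 2) by nra.
  assert (E3 : mu * om * UU = - (2 * p * om + mu * w1) * U ^ 2).
  { apply (Rmult_eq_reg_l mu); [|lra]. nra. }
  assert (E4 : (1 + p ^ 2) * UU = (mu * p * om ^ 2 - p * s) * U ^ 2) by nra.
  apply (Rmult_eq_reg_r (U ^ 2)); [|lra].
  assert (E5 : (1 + p ^ 2) * (mu * om * UU) = mu * om * ((1 + p ^ 2) * UU)) by ring.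
  rewrite E3, E4 in E5. lra.
Qed.

(** Since Y = Z + m w X, adding (3 - A) times the second equation to the first,
    and using A^2 = 1 + p^2 + m^2 w^2, leaves 2 A X = 0. *)
Lemma graph_equations_incompatible (mu p s w w1 A : R) :
  A ^ 2 = 1 + p ^ 2 + mu ^ 2 * w ^ 2 -> 0 < A -> 0 < mu -> w <> 0 ->
  A * (A - 1) * (A - 2 * 1) * (2 * p * w + mu * w1)
    + mu * w * (3 * 1 - A) * (p * s + mu * p * w ^ 2 + mu ^ 2 * w * w1) = 0 ->
  (1 + p ^ 2) * (2 * p * w + mu * w1) = mu * w * (p * s - mu * p * w ^ 2) ->
  p * (s - mu * w ^ 2) = 0.
Proof.
  intros HS HA Hm Hw E1 E2.
  set (X := 2 * p * w + mu * w1) in *.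
  replace (p * s + mu * p * w ^ 2 + mu ^ 2 * w * w1)
    with ((p * s - mu * p * w ^ 2) + mu * w * X) in E1 by (unfold X; ring).
  assert (H : 2 * A * X = 0).
  { replace 0 with (A * (A - 1) * (A - 2) * X
       + (3 - A) * ((1 + p ^ 2) * X + (A ^ 2 - (1 + p ^ 2)) * X)).
    - ring.
    - rewrite E2. replace (A ^ 2 - (1 + p ^ 2)) with (mu ^ 2 * w ^ 2) by lra.
      rewrite <- E1. ring. }
  assert (HX : X = 0) by nra.
  rewrite HX in E2.
  apply (Rmult_eq_reg_l (mu * w)).
  - lra.
  - apply Rmult_integral_contrapositive_currified; lra.
Qed.

(** Linear equations in (X, Y), with determinant - 12 A m w, so X = Y = 0; and
    Z = Y - m w X. *)
Lemma opposite_graph_equations_incompatible (mu p s w w1 A : R) :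
  0 < A -> 0 < mu -> w <> 0 ->
  A * (A - 1) * (A - 2 * 1) * (2 * p * w + mu * w1)
    + mu * w * (3 * 1 - A) * (p * s + mu * p * w ^ 2 + mu ^ 2 * w * w1) = 0 ->
  A * (A - -1) * (A - 2 * -1) * (2 * p * w + mu * w1)
    + mu * w * (3 * -1 - A) * (p * s + mu * p * w ^ 2 + mu ^ 2 * w * w1) = 0 ->
  p * (s - mu * w ^ 2) = 0.
Proof.
  intros HA Hm Hw E1 E2.
  set (Y := p * s + mu * p * w ^ 2 + mu ^ 2 * w * w1) in *.
  set (X := 2 * p * w + mu * w1) in *.
  assert (Hmw : mu * w <> 0)
    by (apply Rmult_integral_contrapositive_currified; lra).
  assert (Y0 : Y = 0).
  { assert (F1 := f_equal (Rmult ((A + 1) * (A + 2))) E1).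
    assert (F2 := f_equal (Rmult ((A - 1) * (A - 2))) E2).
    apply (Rmult_eq_reg_l (mu * w)); [|exact Hmw]. lra. }
  assert (X0 : X = 0).
  { rewrite Y0 in E1, E2. apply (Rmult_eq_reg_l (A * A)); nra. }
  replace (p * (s - mu * w ^ 2)) with (Y - mu * w * X) by (unfold X, Y; ring).
  rewrite X0, Y0. ring.
Qed.

(** * The metrics are not projectively equivalent *)

(** A reparametrization multiplies u' and v' by the same factor, so the
    alpha-geodesic has the slope function [w] of the F-geodesic. *)
Lemma not_proj_equivalent_of_point (lo hi : Rbar) (m : R -> R) (u0 w0 : R) :
  smooth (open_itv lo hi) m -> (forall u, open_itv lo hi u -> 0 < m u) ->
  open_itv lo hi u0 -> w0 <> 0 -> 3 < graph_alpha m u0 w0 ->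
  Derive m u0 * (Derive (Derive m) u0 - m u0 * w0 ^ 2) <> 0 ->
  ~ proj_equivalent lo hi m (slope m) (alpha m).
Proof.
  intros Hsm Hpos Hu0 Hw0 HA0 Hne [Hequiv _].
  destruct (slope_geodesic_exists lo hi m 1 u0 w0 Hsm Hpos (or_introl eq_refl)
    Hu0 HA0) as (u & v & w & d & Hd & Eu & Ev & Ew & Dw & Hcurve & Hgeo).
  destruct (Hequiv _ _ _ (Hgeo d (conj Hd (Rle_refl d))))
    as (a' & b' & c' & [_ (u' & v' & Hc')] & h & Hh & Hmap & Hsurj).
  assert (T0 : open_itv (- d) d 0) by (apply open_itv_sym; rewrite Rabs_R0; exact Hd).
  assert (same_point : forall t, open_itv (- d) d t ->
    open_itv a' b' (h t) /\ u' (h t) = u t /\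
    cos (v t) = cos (v' (h t)) /\ sin (v t) = sin (v' (h t))).
  { intros t Ht. destruct (Hmap t Ht) as (_ & Hht & Ec).
    split; [exact Hht|].
    destruct (Hc' (h t) Hht) as (_ & Ec' & _). rewrite Ec' in Ec.
    apply (rev_param_inj m); [|exact Ec].
    exact (Hpos _ (proj1 (Hcurve t (proj1 (open_itv_sym d t) Ht)))). }
  assert (velocity : forall t, open_itv (- d) d t ->
    Derive v' (h t) = w (u' (h t)) * Derive u' (h t) /\ Derive u' (h t) <> 0).
  { intros t Ht. destruct (same_point t Ht) as (Hht & Eut & _).
    destruct (Hc' (h t) Hht) as (_ & _ & Du' & Dv' & _).
    destruct (proj2 (Hcurve t (proj1 (open_itv_sym d t) Ht))) as (s & Hs & Dut & Dvt).
    assert (Dh : is_derive h t (Derive h t)) by exact (Derive_correct _ _ (Hh t Ht 1%nat)).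
    assert (Hl := open_open_itv _ _ t Ht).
    assert (E1 : s = Derive h t * Derive u' (h t)).
    { apply (is_derive_unique2 u t); [exact Dut|].
      apply (is_derive_ext_loc (fun z => u' (h z))).
      - revert Hl. apply filter_imp. intros z Hz. now apply same_point.
      - apply (is_derive_comp u' h); [now apply Derive_correct|exact Dh]. }
    assert (E2 : w (u t) * s = Derive h t * Derive v' (h t)).
    { apply (angle_derive_unique v (fun z => v' (h z)) t); [|exact Dvt|].
      - revert Hl. apply filter_imp. intros z Hz. now apply same_point.
      - apply (is_derive_comp v' h); [now apply Derive_correct|exact Dh]. }
    destruct (Hmap t Ht) as (Hh1 & _).
    split.
    - rewrite Eut. apply (Rmult_eq_reg_l (Derive h t)); [|lra].
      rewrite <- E2, E1. ring.
    - intros E. rewrite E in E1. lra. }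
  destruct (same_point 0 T0) as (Hh0 & Eu0 & _). rewrite Eu in Eu0.
  apply Hne, (graph_equations_incompatible (m u0) (Derive m u0)
    (Derive (Derive m) u0) w0
    (- clairaut_u m 1 u0 w0 / clairaut_w m 1 u0 w0) (graph_alpha m u0 w0)); auto.
  - apply graph_alpha_sqr.
  - lra.
  - exact (slope_graph_equation m 1 u0 w0 (Hpos _ Hu0) (or_introl eq_refl) HA0).
  - rewrite <- Ew, <- Eu0 at 1.
    assert (G := alpha_graph_equation lo hi a' b' m u' v' w (h 0)
      (- clairaut_u m 1 u0 w0 / clairaut_w m 1 u0 w0) Hsm Hh0).
    rewrite Eu0, Ew in G. rewrite Eu0, Ew.
    apply G; [|exact Dw|now apply Hpos].
    intros s Hs. destruct (Hsurj s Hs) as (t & Ht & <-).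
    destruct (velocity t Ht) as [S1 S2].
    destruct (Hc' (h t) Hs) as (I' & _ & Du' & _ & D2u' & _ & _ & Eu' & Ev').
    exact (conj I' (conj Du' (conj D2u' (conj S2 (conj S1 (conj Eu' Ev')))))).
Qed.

(** * The slope metric is not projectively flat *)

Definition d1 (W : R * R -> R) (p : R * R) : R :=
  Derive (fun z => W (z, snd p)) (fst p).
Definition d2 (W : R * R -> R) (p : R * R) : R :=
  Derive (fun z => W (fst p, z)) (snd p).

Lemma smooth2_d1 (D : R * R -> Prop) (W : R * R -> R) :
  smooth2 D W -> smooth2 D (d1 W).
Proof. intros H x y Dxy n. apply (H x y Dxy (S n)). Qed.

Lemma smooth2_d2 (D : R * R -> Prop) (W : R * R -> R) :
  smooth2 D W -> smooth2 D (d2 W).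
Proof. intros H x y Dxy n. apply (H x y Dxy (S n)). Qed.

Lemma smooth2_chain (D : R * R -> Prop) (W : R * R -> R) (f g : R -> R)
    (t a b : R) :
  open D -> smooth2 D W -> D (f t, g t) -> is_derive f t a -> is_derive g t b ->
  is_derive (fun s => W (f s, g s)) t
    (d1 W (f t, g t) * a + d2 W (f t, g t) * b).
Proof.
  intros HD HW Ht Hf Hg. apply is_derive_Reals.
  apply (derivable_pt_lim_comp_2d (fun x y => W (x, y)) f g);
    [|now apply is_derive_Reals|now apply is_derive_Reals].
  apply (differentiable_of_partials (fun x y => W (x, y))
    (fun x y => d1 W (x, y)) (fun x y => d2 W (x, y))).
  - apply locally_2d_locally. generalize (HD _ Ht). apply filter_imp.
    intros [x y] Hxy. apply Derive_correct, (HW x y Hxy 1%nat).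
  - apply Derive_correct, (HW _ _ Ht 1%nat).
  - apply (HW _ _ Ht 1%nat).
Qed.

Lemma is_derive_zero_of_constant (f : R -> R) (d t a c : R) :
  Rabs t < d -> (forall s, Rabs s < d -> f s = c) -> is_derive f t a -> a = 0.
Proof.
  intros Ht Hc Hf. apply (is_derive_unique2 f t); [exact Hf|].
  apply (is_derive_ext_loc (fun _ => c)).
  - replace t with (t - 0) in Ht by ring.
    generalize (locally_near 0 d t Ht). apply filter_imp. intros s Hs.
    symmetry. apply Hc. now rewrite Rminus_0_r in Hs.
  - apply (@is_derive_const R_AbsRing R_NormedModule).
Qed.

(** First and second derivatives of [W] along the graph of a primitive of w,
    with respect to u. *)
Definition graph_d (W : R * R -> R) (w : R) (p : R * R) : R :=
  d1 W p + w * d2 W p.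

Definition graph_dd (W : R * R -> R) (w w1 : R) (p : R * R) : R :=
  graph_d (d1 W) w p + w * graph_d (d2 W) w p + w1 * d2 W p.

(** On a straight segment the image of the tangent is always parallel to the
    direction [e], hence so is its derivative; thus first and second derivative
    are parallel to each other.  The conclusion does not mention [e] or the
    orientation, and can be compared for two curves with one tangent line. *)
Lemma straight_curve_second_order (D : R * R -> Prop) (P1 P2 : R * R -> R)
    (u v w : R -> R) (d w1 : R) (q e : R * R) :
  open D -> smooth2 D P1 -> smooth2 D P2 -> 0 < d ->
  (forall t, Rabs t < d -> D (u t, v t) /\
     exists s, s <> 0 /\ is_derive u t s /\ is_derive v t (w (u t) * s)) ->
  is_derive w (u 0) w1 -> e <> (0, 0) ->
  (forall t, Rabs t < d -> exists s,
     (P1 (u t, v t), P2 (u t, v t)) = (fst q + s * fst e, snd q + s * snd e)) ->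
  graph_d P1 (w (u 0)) (u 0, v 0) * graph_dd P2 (w (u 0)) w1 (u 0, v 0)
  = graph_d P2 (w (u 0)) (u 0, v 0) * graph_dd P1 (w (u 0)) w1 (u 0, v 0).
Proof.
  intros HD H1 H2 Hd Hc Hw He Hline.
  destruct q as [q1 q2], e as [e1 e2]; simpl in Hline.
  assert (first : forall t, Rabs t < d ->
    e1 * graph_d P2 (w (u t)) (u t, v t) - e2 * graph_d P1 (w (u t)) (u t, v t) = 0).
  { intros t Ht. destruct (Hc t Ht) as (HDt & s & Hs & Du & Dv).
    assert (X1 := smooth2_chain D P1 u v t _ _ HD H1 HDt Du Dv).
    assert (X2 := smooth2_chain D P2 u v t _ _ HD H2 HDt Du Dv).
    assert (Z : is_derive (fun t => e1 * P2 (u t, v t) - e2 * P1 (u t, v t)) t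
       (e1 * (d1 P2 (u t, v t) * s + d2 P2 (u t, v t) * (w (u t) * s))
        - e2 * (d1 P1 (u t, v t) * s + d2 P1 (u t, v t) * (w (u t) * s)))).
    { apply (@is_derive_minus R_AbsRing R_NormedModule);
        now apply is_derive_scal. }
    apply (is_derive_zero_of_constant _ d t _ (e1 * q2 - e2 * q1)) in Z; auto.
    - apply (Rmult_eq_reg_r s); [|exact Hs]. unfold graph_d. lra.
    - intros z Hz. destruct (Hline z Hz) as [x E]. injection E as -> ->. ring. }
  assert (T0 : Rabs 0 < d) by now rewrite Rabs_R0.
  destruct (Hc 0 T0) as (HD0 & s & Hs & Du & Dv).
  assert (second : forall P, smooth2 D P ->
    is_derive (fun t => graph_d P (w (u t)) (u t, v t)) 0
      (s * graph_dd P (w (u 0)) w1 (u 0, v 0))).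
  { intros P HP.
    assert (X1 := smooth2_chain D _ u v 0 _ _ HD (smooth2_d1 D P HP) HD0 Du Dv).
    assert (X2 := smooth2_chain D _ u v 0 _ _ HD (smooth2_d2 D P HP) HD0 Du Dv).
    assert (X3 : is_derive (fun t => w (u t)) 0 (s * w1))
      by now apply (is_derive_comp w u).
    evar_last.
    - apply (@is_derive_plus R_AbsRing R_NormedModule); [exact X1|].
      apply (is_derive_Rmult (fun t => w (u t)) (fun t => d2 P (u t, v t)));
        [exact X3|exact X2].
    - unfold plus; simpl. unfold graph_dd, graph_d. ring. }
  assert (Z : e1 * (s * graph_dd P2 (w (u 0)) w1 (u 0, v 0))
            - e2 * (s * graph_dd P1 (w (u 0)) w1 (u 0, v 0)) = 0).
  { apply (is_derive_zero_of_constant (fun t =>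
      e1 * graph_d P2 (w (u t)) (u t, v t) - e2 * graph_d P1 (w (u t)) (u t, v t))
      d 0 _ 0 T0 first).
    apply (@is_derive_minus R_AbsRing R_NormedModule); apply is_derive_scal; auto. }
  assert (F := first 0 T0).
  set (S1 := graph_d P1 _ _) in *. set (S2 := graph_d P2 _ _) in *.
  set (T1 := graph_dd P1 _ _ _) in *. set (T2 := graph_dd P2 _ _ _) in *.
  assert (Z' : e1 * T2 - e2 * T1 = 0) by (apply (Rmult_eq_reg_l s); lra).
  clear - F Z' He.
  destruct (Req_dec e1 0) as [E1|E1].
  - subst e1. assert (e2 <> 0) by (intros ->; now apply He).
    assert (S1 = 0) by (apply (Rmult_eq_reg_l e2); lra).
    assert (T1 = 0) by (apply (Rmult_eq_reg_l e2); lra).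
    subst. nra.
  - apply (Rmult_eq_reg_l e1); [|exact E1].
    replace (e1 * (S1 * T2)) with (S1 * (e1 * T2)) by ring.
    replace (e1 * (S2 * T1)) with ((e1 * S2) * T1) by ring.
    replace (e1 * T2) with (e2 * T1) by lra.
    replace (e1 * S2) with (e2 * S1) by lra. ring.
Qed.

Lemma continuous_pair {T U V : UniformSpace} (f : T -> U) (g : T -> V) (x : T) :
  continuous f x -> continuous g x -> continuous (fun z => (f z, g z)) x.
Proof.
  intros Hf Hg. apply filterlim_locally. intros eps.
  generalize (filter_and _ _ (proj1 (filterlim_locally _ _) Hf eps)
                             (proj1 (filterlim_locally _ _) Hg eps)).
  apply filter_imp. intros z [H1 H2]. now split.
Qed.

Lemma continuous_rev_param (m : R -> R) (x : R * R) :
  continuous m (fst x) -> continuous (rev_param m) x.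
Proof.
  intros Hm. unfold rev_param.
  assert (C1 : continuous (fun x : R * R => m (fst x)) x)
    by (apply (continuous_comp fst m); [apply continuous_fst|exact Hm]).
  apply (continuous_pair (fun x => (m (fst x) * cos (snd x), m (fst x) * sin (snd x))) fst);
    [|apply continuous_fst].
  apply (continuous_pair (fun x => m (fst x) * cos (snd x)) (fun x => m (fst x) * sin (snd x)));
    apply (continuous_mult (K:=R_AbsRing)); try exact C1.
  - apply (continuous_comp snd cos); [apply continuous_snd|apply continuous_cos].
  - apply (continuous_comp snd sin); [apply continuous_snd|apply continuous_sin].
Qed.

Lemma open_coordinate_domain (lo hi : Rbar) (m : R -> R) (U : R * R * R -> Prop) :
  smooth (open_itv lo hi) m -> open U ->
  open (fun x : R * R => open_itv lo hi (fst x) /\ U (rev_param m x)).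
Proof.
  intros Hsm HU [a b] [Ix Ux]. simpl in Ix. apply filter_and.
  - exact (continuous_fst a b _ (open_open_itv lo hi a Ix)).
  - apply (continuous_rev_param m (a, b)); [|now apply HU].
    apply (@ex_derive_continuous R_AbsRing R_NormedModule).
    exact (Hsm _ Ix 1%nat).
Qed.

(** Composing with the second and third coordinates of chi gives back those of
    rev_param, whose derivatives at v = 0 are (0, 1) along u and (m u0, 0) along
    v; these are independent. *)
Lemma local_coordinates_jacobian (lo hi : Rbar) (m : R -> R) U V phi chi (u0 : R) :
  smooth (open_itv lo hi) m -> 0 < m u0 ->
  local_coordinates lo hi m U V phi chi ->
  open_itv lo hi u0 -> U (rev_param m (u0, 0)) ->
  d1 (fun x => fst (phi (rev_param m x))) (u0, 0)
    * d2 (fun x => snd (phi (rev_param m x))) (u0, 0)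
  <> d1 (fun x => snd (phi (rev_param m x))) (u0, 0)
    * d2 (fun x => fst (phi (rev_param m x))) (u0, 0).
Proof.
  intros Hsm Hm (HU & HV & Hphi & _ & S1 & S2 & _ & C2 & C3) Hu0 HU0 HJ.
  assert (HD := open_coordinate_domain lo hi m U Hsm HU).
  set (D := fun x : R * R => open_itv lo hi (fst x) /\ U (rev_param m x)) in *.
  set (P1 := fun x => fst (phi (rev_param m x))) in *.
  set (P2 := fun x => snd (phi (rev_param m x))) in *.
  assert (D0 : D (u0, 0)) by now split.
  assert (inv : forall x, D x ->
    V (P1 x, P2 x) /\ chi (P1 x, P2 x) = rev_param m x).
  { intros [a b] [Ia Ub]. unfold P1, P2. rewrite <- surjective_pairing.
    apply Hphi; [now exists a, b|exact Ub]. }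
  assert (idd := fun x : R => is_derive_id (K:=R_AbsRing) x).
  assert (cst := fun c x : R => is_derive_const (K:=R_AbsRing) (V:=R_NormedModule) c x).
  assert (along : forall (f g : R -> R) (t a b : R) (C : R * R -> R),
    (f t, g t) = (u0, 0) -> is_derive f t a -> is_derive g t b -> smooth2 V C ->
    is_derive (fun s => C (P1 (f s, g s), P2 (f s, g s))) t
      (d1 C (P1 (u0, 0), P2 (u0, 0)) * (d1 P1 (u0, 0) * a + d2 P1 (u0, 0) * b)
       + d2 C (P1 (u0, 0), P2 (u0, 0)) * (d1 P2 (u0, 0) * a + d2 P2 (u0, 0) * b))).
  { intros f g t a b C E Hf Hg HC.
    assert (Dt : D (f t, g t)) by now rewrite E.
    assert (K := smooth2_chain V C (fun s => P1 (f s, g s)) (fun s => P2 (f s, g s)) t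
      _ _ HV HC (proj1 (inv _ Dt))
      (smooth2_chain D P1 f g t a b HD S1 Dt Hf Hg)
      (smooth2_chain D P2 f g t a b HD S2 Dt Hf Hg)).
    cbv beta in K. rewrite E in K. exact K. }
  assert (L1 : locally u0 (fun s => D (s, 0))).
  { apply (continuous_pair (fun s : R => s) (fun _ : R => 0) u0);
      [apply continuous_id|apply continuous_const|now apply HD]. }
  assert (L2 : locally 0 (fun s => D (u0, s))).
  { apply (continuous_pair (fun _ : R => u0) (fun s : R => s) 0);
      [apply continuous_const|apply continuous_id|now apply HD]. }
  assert (E1 := along (fun s => s) (fun _ => 0) u0 1 0 _ eq_refl (idd u0) (cst 0 u0) C3).
  assert (E2 := along (fun _ => u0) (fun s => s) 0 0 1 _ eq_refl (cst u0 0) (idd 0) C3).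
  assert (E3 := along (fun _ => u0) (fun s => s) 0 0 1 _ eq_refl (cst u0 0) (idd 0) C2).
  assert (F1 : is_derive (fun s : R => snd (chi (P1 (s, 0), P2 (s, 0)))) u0 1).
  { apply (is_derive_ext_loc (fun s => s)); [|apply idd].
    revert L1. apply filter_imp. intros s Hs.
    exact (eq_sym (f_equal snd (proj2 (inv _ Hs)))). }
  assert (F2 : is_derive (fun s : R => snd (chi (P1 (u0, s), P2 (u0, s)))) 0 0).
  { apply (is_derive_ext_loc (fun s => u0)); [|apply cst].
    revert L2. apply filter_imp. intros s Hs.
    exact (eq_sym (f_equal snd (proj2 (inv _ Hs)))). }
  assert (F3 : is_derive (fun s : R => snd (fst (chi (P1 (u0, s), P2 (u0, s))))) 0 (m u0)).
  { apply (is_derive_ext_loc (fun s => m u0 * sin s)).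
    - revert L2. apply filter_imp. intros s Hs.
      exact (eq_sym (f_equal (fun p => snd (fst p)) (proj2 (inv _ Hs)))).
    - auto_derive; [exact I|]. rewrite cos_0. ring. }
  apply (is_derive_unique2 _ _ _ _ F1) in E1.
  apply (is_derive_unique2 _ _ _ _ F2) in E2.
  apply (is_derive_unique2 _ _ _ _ F3) in E3.
  set (a := d1 P1 (u0, 0)) in *. set (b := d2 P1 (u0, 0)) in *.
  set (c := d1 P2 (u0, 0)) in *. set (d := d2 P2 (u0, 0)) in *.
  revert E1 E2 E3.
  generalize (d1 (fun x => snd (chi x)) (P1 (u0, 0), P2 (u0, 0))).
  generalize (d2 (fun x => snd (chi x)) (P1 (u0, 0), P2 (u0, 0))).
  generalize (d1 (fun x => snd (fst (chi x))) (P1 (u0, 0), P2 (u0, 0))).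
  generalize (d2 (fun x => snd (fst (chi x))) (P1 (u0, 0), P2 (u0, 0))).
  clearbody a b c d. clear - HJ Hm.
  intros y2 x2 y3 x3 E1 E2 E3.
  assert (d0 : d = 0).
  { replace d with (d * (x3 * (a * 1 + b * 0) + y3 * (c * 1 + d * 0)))
      by (rewrite <- E1; ring).
    replace (d * (x3 * (a * 1 + b * 0) + y3 * (c * 1 + d * 0)))
      with (x3 * (a * d) + y3 * c * d) by ring.
    rewrite HJ.
    replace (x3 * (c * b) + y3 * c * d)
      with (c * (x3 * (a * 0 + b * 1) + y3 * (c * 0 + d * 1))) by ring.
    rewrite <- E2. ring. }
  assert (b0 : b = 0).
  { replace b with (b * (x3 * (a * 1 + b * 0) + y3 * (c * 1 + d * 0)))
      by (rewrite <- E1; ring).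
    replace (b * (x3 * (a * 1 + b * 0) + y3 * (c * 1 + d * 0)))
      with (x3 * a * b + y3 * (c * b)) by ring.
    rewrite <- HJ.
    replace (x3 * a * b + y3 * (a * d))
      with (a * (x3 * (a * 0 + b * 1) + y3 * (c * 0 + d * 1))) by ring.
    rewrite <- E2. ring. }
  rewrite d0, b0 in E3. lra.
Qed.

(** The geodesic is first shortened until it lies in the coordinate domain. *)
Lemma flat_slope_geodesic (lo hi : Rbar) (m : R -> R) (e u0 w0 : R) U V phi chi :
  smooth (open_itv lo hi) m -> (forall u, open_itv lo hi u -> 0 < m u) ->
  e = 1 \/ e = -1 -> open_itv lo hi u0 -> 3 < graph_alpha m u0 w0 ->
  local_coordinates lo hi m U V phi chi -> U (rev_param m (u0, 0)) ->
  (forall a b c, geodesic lo hi m (slope m) a b c ->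
     (forall t, open_itv a b t -> U (c t)) ->
     straight_segment (fun x => exists t, open_itv a b t /\ x = phi (c t))) ->
  let P1 := fun x => fst (phi (rev_param m x)) in
  let P2 := fun x => snd (phi (rev_param m x)) in
  let w1 := - clairaut_u m e u0 w0 / clairaut_w m e u0 w0 in
  graph_d P1 w0 (u0, 0) * graph_dd P2 w0 w1 (u0, 0)
  = graph_d P2 w0 (u0, 0) * graph_dd P1 w0 w1 (u0, 0).
Proof.
  intros Hsm Hpos He Hu0 HA0 (HU & _ & _ & _ & S1 & S2 & _) HU0 Hflat P1 P2 w1.
  assert (HD := open_coordinate_domain lo hi m U Hsm HU).
  destruct (slope_geodesic_exists lo hi m e u0 w0 Hsm Hpos He Hu0 HA0)
    as (u & v & w & d & Hd & Eu & Ev & Ew & Dw & Hcurve & Hgeo).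
  assert (T0 : Rabs 0 < d) by now rewrite Rabs_R0.
  assert (HL : locally 0 (fun t => open_itv lo hi (u t) /\ U (rev_param m (u t, v t)))).
  { destruct (Hcurve 0 T0) as (_ & s & _ & Du & Dv).
    assert (Cu : continuous u 0).
    { apply (@ex_derive_continuous R_AbsRing R_NormedModule). eexists; exact Du. }
    assert (Cv : continuous v 0).
    { apply (@ex_derive_continuous R_AbsRing R_NormedModule). eexists; exact Dv. }
    refine (continuous_pair u v 0 Cu Cv _ (HD (u 0, v 0) _)).
    rewrite Eu, Ev. now split. }
  destruct HL as [r Hr].
  assert (HU' : forall t, Rabs t < r -> open_itv lo hi (u t) /\ U (rev_param m (u t, v t))).
  { intros t Ht. apply Hr. change (Rabs (t - 0) < r). now rewrite Rminus_0_r. }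
  pose (d' := Rmin d r).
  assert (Hd' : 0 < d' <= d)
    by (split; [apply Rmin_glb_lt; [exact Hd|apply cond_pos]|apply Rmin_l]).
  assert (Hd'r : d' <= r) by apply Rmin_r.
  destruct (Hflat _ _ _ (Hgeo d' Hd')) as (q & dir & a & b & Hdir & _ & Hseg).
  { intros t Ht. apply open_itv_sym in Ht. apply HU'. lra. }
  assert (G := straight_curve_second_order _ P1 P2 u v w d' w1 q dir
    HD S1 S2 (proj1 Hd')).
  rewrite Eu, Ev, Ew in G. apply G; auto.
  - intros t Ht. destruct (Hcurve t ltac:(lra)) as [It Hs].
    split; [apply HU'; lra|exact Hs].
  - intros t Ht.
    destruct (proj1 (Hseg (phi (rev_param m (u t, v t))))) as (s & _ & Es).
    { exists t. split; [now apply open_itv_sym|reflexivity]. }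
    exists s. rewrite <- Es. symmetry. apply surjective_pairing.
Qed.

(** Subtracting the conditions for e = 1 and e = -1 leaves the difference of the
    two values of w', times the Jacobian. *)
Lemma not_proj_flat_of_point (lo hi : Rbar) (m : R -> R) (u0 w0 : R) :
  smooth (open_itv lo hi) m -> (forall u, open_itv lo hi u -> 0 < m u) ->
  open_itv lo hi u0 -> w0 <> 0 -> 3 < graph_alpha m u0 w0 ->
  Derive m u0 * (Derive (Derive m) u0 - m u0 * w0 ^ 2) <> 0 ->
  ~ proj_flat lo hi m (slope m).
Proof.
  intros Hsm Hpos Hu0 Hw0 HA0 Hne Hflat.
  destruct (Hflat (rev_param m (u0, 0))) as (U & V & phi & chi & Hcoord & HU0 & Hseg).
  { now exists u0, 0. }
  assert (HJ := local_coordinates_jacobian lo hi m U V phi chi u0 Hsm (Hpos _ Hu0)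
                  Hcoord Hu0 HU0).
  assert (G := fun e He => flat_slope_geodesic lo hi m e u0 w0 U V phi chi Hsm Hpos
                  He Hu0 HA0 Hcoord HU0 Hseg).
  cbv zeta in G.
  assert (Gp := G 1 (or_introl eq_refl)). assert (Gm := G (-1) (or_intror eq_refl)).
  assert (Sp := slope_graph_equation m 1 u0 w0 (Hpos _ Hu0) (or_introl eq_refl) HA0).
  assert (Sm := slope_graph_equation m (-1) u0 w0 (Hpos _ Hu0) (or_intror eq_refl) HA0).
  cbv zeta in Sp, Sm.
  revert Gp Gm Sp Sm.
  generalize (- clairaut_u m 1 u0 w0 / clairaut_w m 1 u0 w0).
  generalize (- clairaut_u m (-1) u0 w0 / clairaut_w m (-1) u0 w0).
  intros wm wp Gp Gm Sp Sm.
  assert (E : wp = wm).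
  { unfold graph_dd in Gp, Gm. unfold graph_d at 1 4 in Gp. unfold graph_d at 1 4 in Gm.
    set (P1 := fun x => fst (phi (rev_param m x))) in *.
    set (P2 := fun x => snd (phi (rev_param m x))) in *.
    apply (Rmult_eq_reg_r (d1 P1 (u0, 0) * d2 P2 (u0, 0)
                           - d1 P2 (u0, 0) * d2 P1 (u0, 0))); [|lra].
    lra. }
  subst wm.
  apply Hne, (opposite_graph_equations_incompatible (m u0) (Derive m u0)
    (Derive (Derive m) u0) w0 wp (graph_alpha m u0 w0)); auto.
  lra.
Qed.

(** * Choice of the point and of the direction *)

Lemma open_itv_inhabited (lo hi : Rbar) :
  Rbar_lt lo hi -> exists x, open_itv lo hi x.
Proof.
  destruct lo as [a| |], hi as [b| |]; simpl; intros H; try contradiction.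
  - exists ((a + b) / 2). split; simpl; lra.
  - exists (a + 1). split; simpl; [lra|exact I].
  - exists (b - 1). split; simpl; [exact I|lra].
  - exists 0. split; exact I.
Qed.

Lemma Derive_neq_0_of_slope_bound (lo hi : Rbar) (m : R -> R) (u : R) :
  slope_strongly_convex lo hi m -> open_itv lo hi u -> Derive m u <> 0.
Proof.
  intros [Hlt _] Hu E.
  assert (H := Hlt u 0 1 0 Hu ltac:(intros F; injection F; lra)).
  unfold beta, alpha in H. rewrite E in H.
  replace ((1 + 0 ^ 2) * 1 ^ 2 + m u ^ 2 * 0 ^ 2) with 1 in H by ring.
  rewrite sqrt_1 in H. lra.
Qed.

Theorem proposition4p11 (lo hi : Rbar) (m : R -> R)
    (hI : Rbar_lt lo hi)
    (hpos : forall u, open_itv lo hi u -> 0 < m u)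
    (hsmooth : smooth (open_itv lo hi) m)
    (hconv : slope_strongly_convex lo hi m) :
  ~ proj_equivalent lo hi m (slope m) (alpha m) /\
  ~ proj_flat lo hi m (slope m).
Proof.
  destruct (open_itv_inhabited lo hi hI) as [u0 Hu0].
  assert (Hm := hpos u0 Hu0).
  assert (Hp := Derive_neq_0_of_slope_bound lo hi m u0 hconv Hu0).
  pose (s := Derive (Derive m) u0).
  (* Then w0 > 1 and m u0 * w0 exceeds both 3 and the second derivative. *)
  pose (w0 := 1 + (3 + Rabs s) / m u0).
  assert (Hs := Rabs_pos s). assert (Hs' := Rle_abs s).
  assert (Hw1 : 1 < w0).
  { unfold w0. assert (0 < (3 + Rabs s) / m u0) by (apply Rdiv_lt_0_compat; lra). lra. }
  assert (Hmw : m u0 * w0 = m u0 + 3 + Rabs s) by (unfold w0; field; lra).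
  assert (HA : 3 < graph_alpha m u0 w0).
  { apply Rnot_le_lt. intros Hle.
    assert (HS := graph_alpha_sqr m u0 w0). assert (HA := graph_alpha_pos m u0 w0).
    assert (graph_alpha m u0 w0 ^ 2 <= 9) by nra.
    assert (9 < (m u0 * w0) ^ 2) by (rewrite Hmw; nra).
    nra. }
  assert (Hne : Derive m u0 * (Derive (Derive m) u0 - m u0 * w0 ^ 2) <> 0).
  { apply Rmult_integral_contrapositive_currified; [exact Hp|].
    fold s. replace (m u0 * w0 ^ 2) with (m u0 * w0 * w0) by ring.
    rewrite Hmw. nra. }
  assert (Hw0 : w0 <> 0) by lra.
  split.
  - now apply (not_proj_equivalent_of_point lo hi m u0 w0).
  - now apply (not_proj_flat_of_point lo hi m u0 w0).
Qed.
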